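(* Assume that $\Omega\subset\mathbb{R}^d$ is a bounded Lipschitz domain. Then all steady states $(v,w)$, i.e. all solutions (with $w\ge0$) of the coupled degenerate elliptic system $$0=\operatorname{div}(\eta(w)\nabla v),\qquad 0=\operatorname{div}(\kappa(w)\nabla w)+\eta(w)|\nabla v|^2\quad\text{in }\Omega,$$ $$0=\eta(w)\nabla v\cdot\mathrm n,\qquad 0=\kappa(w)\nabla w\cdot\mathrm n\quad\text{on }\partial\Omega,$$ are given either by the trivial ones, $(v,w)=(V_{\mathrm{st}},0)$ where $V_{\mathrm{st}}$ is arbitrary, or by the spatially constant ones, namely $$(v,w)\equiv\Big(\frac1{|\Omega|}V_0,\ \frac1{|\Omega|}W_0\Big),$$ where $V_0$ and $W_0$ are uniquely given by the conserved quantities $\int_\Omega v\,dx=V_0$ and $\int_\Omega\big(\frac12v^2+w\big)\,dx=E_0=W_0+\frac1{2|\Omega|}V_0^2$.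
   Context: The functions $\eta,\kappa:[0,\infty[\to[0,\infty[$ are a degenerate viscosity and energy-transport coefficient: they are continuous with $\eta(0)=\kappa(0)=0$ and $\eta(w),\kappa(w)>0$ for $w>0$; the main choice is $\eta(w)=\eta_0w^\alpha$, $\kappa(w)=\kappa_0w^\beta$ with $\alpha,\beta,\eta_0,\kappa_0>0$. The unknowns are $v$ (real-valued) and $w\ge0$; $\mathrm n$ is the outer unit normal on $\partial\Omega$ and $|\Omega|$ is the Lebesgue measure of $\Omega$. The steady states are the time-independent solutions of $\dot v=\operatorname{div}(\eta(w)\nabla v)$, $\dot w=\operatorname{div}(\kappa(w)\nabla w)+\eta(w)|\nabla v|^2$ with no-flux boundary conditions. *)

(* Defs.v *)
From HB Require Import structures.
From mathcomp Require Import all_boot all_order all_algebra.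
From mathcomp Require Import all_classical all_reals all_analysis.

Set Implicit Arguments.
Unset Strict Implicit.
Unset Printing Implicit Defensive.
Import Order.TTheory GRing.Theory Num.Theory.
Import numFieldNormedType.Exports.

Local Open Scope classical_set_scope.
Local Open Scope ring_scope.

Definition rV_display : measure_display.
Proof. by []. Qed.

(* The sigma-algebra of ['rV[R]_n] is the product one, which is also the Borel
   one, 'rV[R]_n being second countable. *)
Section measurable_rV.
Variables (R : realType) (n : nat).

Definition rV_coord (i : 'I_n) (x : 'rV[R]_n) : measurableTypeR R := x ord0 i.

Let rV_set0 : g_sigma_preimage rV_coord set0.
Proof. exact: sigma_algebra0. Qed.

Let rV_setC A : g_sigma_preimage rV_coord A -> g_sigma_preimage rV_coord (~` A).
Proof. exact: sigma_algebraC. Qed.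

Let rV_bigcup (F : (set 'rV[R]_n)^nat) :
  (forall i, g_sigma_preimage rV_coord (F i)) ->
  g_sigma_preimage rV_coord (\bigcup_i F i).
Proof. exact: sigma_algebra_bigcup. Qed.

HB.instance Definition _ := @isMeasurable.Build rV_display
  'rV[R]_n (g_sigma_preimage rV_coord) rV_set0 rV_setC rV_bigcup.

End measurable_rV.

Section lebesgue_rV.
Variable R : realType.

Lemma measurable_rV_coord n (i : 'I_n) :
  measurable_fun setT (@rV_coord R n i).
Proof.
move=> _ Y mY; rewrite setTI; apply: sub_sigma_algebra => /=.
rewrite -bigcup_seq/=; exists i => /=; first by rewrite mem_index_enum.
by exists Y => //; rewrite setTI.
Qed.

Lemma measurable_fun_rVP d (T : measurableType d) n (f : T -> 'rV[R]_n) :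
  (forall i, measurable_fun setT (rV_coord i \o f)) -> measurable_fun setT f.
Proof.
move=> mf _ A mA; rewrite setTI.
have : preimage_set_system setT f (g_sigma_preimage (@rV_coord R n)) (f @^-1` A).
  by exists A => //; rewrite setTI.
rewrite -g_sigma_preimage_comp; apply: smallest_sub.
  exact: sigma_algebra_measurable.
move=> B; rewrite -bigcup_seq => -[i _ [C mC <-]]; exact: mf.
Qed.

Definition rV_cons n (p : 'rV[R]_n * measurableTypeR R) : 'rV[R]_n.+1 :=
  row_mx (const_mx p.2 : 'rV_1) p.1.

Lemma measurable_rV_cons n : measurable_fun setT (@rV_cons n).
Proof.
apply: measurable_fun_rVP => i; rewrite /rV_coord /rV_cons.
case: (@split_ordP 1 n i) => j ij.
  apply: (eq_measurable_fun snd); last exact: measurable_snd.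
  by move=> x _; rewrite [RHS]/= ij (@row_mxEl _ 1 1 n) mxE.
apply: (eq_measurable_fun (rV_coord j \o fst)).
  by move=> x _; rewrite [RHS]/= ij (@row_mxEr _ 1 1 n).
by apply: measurableT_comp; [exact: measurable_rV_coord|exact: measurable_fst].
Qed.

HB.instance Definition _ n := @isMeasurableFun.Build _ _ _ _ (@rV_cons n)
  (@measurable_rV_cons n).

Section lebesgue_rV_cons.
Variables (n : nat) (mu : {measure set 'rV[R]_n -> \bar R}).

Definition lebesgue_rV_cons : set 'rV[R]_n.+1 -> \bar R :=
  pushforward (mu \x lebesgue_measure)%E (@rV_cons n).

Let lebesgue_rV_cons0 : lebesgue_rV_cons set0 = 0%E.
Proof. exact: measure0. Qed.

Let lebesgue_rV_cons_ge0 A : (0 <= lebesgue_rV_cons A)%E.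
Proof. exact: measure_ge0. Qed.

Let lebesgue_rV_cons_sigma_additive : semi_sigma_additive lebesgue_rV_cons.
Proof. exact: measure_semi_sigma_additive. Qed.

HB.instance Definition _ := isMeasure.Build _ _ _ lebesgue_rV_cons
  lebesgue_rV_cons0 lebesgue_rV_cons_ge0 lebesgue_rV_cons_sigma_additive.

End lebesgue_rV_cons.

(* The Lebesgue measure of R^n, by recursion on n: the unit mass at the only
   point of R^0, then the product with the Lebesgue measure of R. *)
Fixpoint lebesgue_rV n : {measure set 'rV[R]_n -> \bar R} :=
  match n with
  | 0%N => \d_ (0 : 'rV[R]_0)
  | m.+1 => lebesgue_rV_cons (lebesgue_rV m)
  end.

Lemma lebesgue_rV_box n (a b : 'I_n -> R) : (forall i, a i <= b i) ->
  lebesgue_rV n [set x | forall i, x ord0 i \in `[a i, b i]]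
  = (\prod_(i < n) (b i - a i))%:E.
Proof.
elim: n a b => [|n IH] a b ab.
  rewrite big_ord0 /= diracE mem_set//=; by case.
have mI i : measurable ([set` `[a i, b i]] : set (measurableTypeR R)).
  exact: measurable_itv.
rewrite /= /lebesgue_rV_cons /pushforward.
rewrite (_ : _ @^-1` _ =
  [set x : 'rV[R]_n | forall i, x ord0 i \in `[a (lift ord0 i), b (lift ord0 i)]]
   `*` [set` `[a ord0, b ord0]]); last first.
  have E0 (p : 'rV[R]_n * R) : rV_cons p ord0 ord0 = p.2.
    rewrite /rV_cons (_ : ord0 = @lshift 1 n ord0); last exact/val_inj.
    by rewrite (@row_mxEl _ 1 1 n) mxE.
  have E1 (p : 'rV[R]_n * R) i : rV_cons p ord0 (lift ord0 i) = p.1 ord0 i.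
    rewrite /rV_cons (_ : lift ord0 i = @rshift 1 n i); last exact/val_inj.
    by rewrite (@row_mxEr _ 1 1 n).
  apply/seteqP; split=> [p /= h|p /= [h1 h2] i].
    by split=> [i|]; [have := h (lift ord0 i); rewrite E1|have := h ord0; rewrite E0].
  by case: (unliftP ord0 i) => [j|] ->; rewrite ?E1 ?E0.
rewrite product_measure1E//; last first.
  rewrite (_ : [set _ | _] =
    \big[setI/setT]_(i < n) (rV_coord i @^-1` [set` `[a (lift ord0 i), b (lift ord0 i)]])).
    apply: bigsetI_measurable => i _; rewrite -[X in measurable X]setTI.
    exact: measurable_rV_coord.
  apply/seteqP; split=> x /=.
    by move=> h; rewrite -bigcap_seq => i _; exact: h.
  by rewrite -bigcap_seq => h i; apply: h; rewrite /= mem_index_enum.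
rewrite IH// big_ord_recl EFinM muleC; congr (_ * _)%E.
rewrite [LHS](lebesgue_measure_itv `[a ord0, b ord0])/= lte_fin.
have := ab ord0; rewrite le_eqVlt => /predU1P[->|->//].
by rewrite ltxx subrr.
Qed.

End lebesgue_rV.

Section domains.
Variables (R : realType) (d : nat).
Implicit Type Omega : set 'rV[R]_d.+1.

(* After a rotation Q of the axes, Omega lies, near each of its boundary points,
   strictly above the graph of a Lipschitz function of the first d coordinates. *)
Definition lipschitz_boundary Omega :=
  forall x, closure Omega x -> ~ Omega° x ->
    exists (r : R) (Q : 'M[R]_d.+1) (gamma : 'rV[R]_d -> R),
      [/\ 0 < r, Q *m Q^T = 1%:M, lipschitz gamma &
        forall y, ball x r y ->
          Omega y <->
          gamma (col' ord_max (y *m Q)) < (y *m Q) ord0 ord_max].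

Definition bounded_lipschitz_domain Omega :=
  [/\ open Omega, connected Omega, Omega !=set0, bounded_set Omega &
      lipschitz_boundary Omega].

End domains.

Section sobolev.
Variables (R : realType) (n : nat).
Local Notation mu := (@lebesgue_rV R n).
Implicit Types (Omega : set 'rV[R]_n) (u v w phi g : 'rV[R]_n -> R)
  (F G : 'rV[R]_n -> 'rV[R]_n).

Definition dotv (x y : 'rV[R]_n) : R := \sum_i x ord0 i * y ord0 i.

Definition grad phi (x : 'rV[R]_n) : 'rV[R]_n :=
  \row_i 'D_(delta_mx ord0 i) phi x.

(* Test functions in C^1_c(Omega); by mollification they define the same weak
   derivatives as those in C^oo_c(Omega). *)
Definition C1c Omega phi :=
  [/\ forall x, differentiable phi x,
      continuous (grad phi) &
      exists K, [/\ compact K, K `<=` Omega & forall x, ~ K x -> phi x = 0]].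

Definition L1 Omega u := mu.-integrable Omega (EFin \o u).

Definition L1loc Omega u :=
  measurable_fun Omega u /\ forall K, compact K -> K `<=` Omega -> L1 K u.

Definition L2 Omega u :=
  measurable_fun Omega u /\ L1 Omega (fun x => u x ^+ 2).

Definition Linfty Omega u :=
  measurable_fun Omega u /\
  exists M : R, {ae mu, forall x, Omega x -> `|u x| <= M}.

Definition coord F i : 'rV[R]_n -> R := fun x => F x ord0 i.

Definition weak_grad Omega u G :=
  [/\ L1loc Omega u, forall i, L1loc Omega (coord G i) &
      forall phi, C1c Omega phi -> forall i,
        \int[mu]_(x in Omega) (u x * coord (grad phi) i x) =
        - \int[mu]_(x in Omega) (coord G i x * phi x)].

Definition W11loc Omega u := exists G, weak_grad Omega u G.

Definition H1_grad Omega u G :=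
  [/\ weak_grad Omega u G, L2 Omega u & forall i, L2 Omega (coord G i)].

Definition weak_div Omega F g :=
  [/\ forall i, L1loc Omega (coord F i), L1loc Omega g &
      forall phi, C1c Omega phi ->
        \int[mu]_(x in Omega) dotv (F x) (grad phi x) =
        - \int[mu]_(x in Omega) (g x * phi x)].

(* The normal trace of F on the boundary of Omega, where F is in L^2 and
   g = div F is in L^1: by Green's formula, the functional
     phi |-> \int_(\partial Omega) (F . n) phi
           = \int_Omega F . grad phi + \int_Omega (div F) phi
   on the phi of H^1 \cap L^oo; here G is the weak gradient of phi. *)
Definition normal_trace Omega F g phi G : R :=
  \int[mu]_(x in Omega) dotv (F x) (G x) + \int[mu]_(x in Omega) (g x * phi x).

Definition no_flux Omega F g :=
  forall phi G, H1_grad Omega phi G -> Linfty Omega phi ->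
    normal_trace Omega F g phi G = 0.

(* Finite-energy weak solutions of the stationary system: the fluxes are square
   integrable and the dissipation eta(w)|grad v|^2 is integrable. *)
Definition steady_state (eta kappa : R -> R) Omega v w :=
  exists Gv Gw,
    let Fv x := eta (w x) *: Gv x in
    let Fw x := kappa (w x) *: Gw x in
    let diss x := eta (w x) * dotv (Gv x) (Gv x) in
    [/\ forall x, Omega x -> 0 <= w x,
        weak_grad Omega v Gv /\ weak_grad Omega w Gw,
        [/\ forall i, L2 Omega (coord Fv i),
            forall i, L2 Omega (coord Fw i) & L1 Omega diss],
        weak_div Omega Fv (cst 0) /\ weak_div Omega Fw (\- diss) &
        no_flux Omega Fv (cst 0) /\ no_flux Omega Fw (\- diss)].

Definition volume Omega : R := fine (mu Omega).

(* p = (V_0, W_0); the second equation is the one for the total energy E_0. *)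
Definition conserved Omega v w (p : R * R) :=
  (\int[mu]_(x in Omega) (v x)%:E = p.1%:E)%E /\
  (\int[mu]_(x in Omega) (2^-1 * v x ^+ 2 + w x)%:E =
    (p.2 + (2 * volume Omega)^-1 * p.1 ^+ 2)%:E)%E.

End sobolev.

(* The coefficients are functions on [0, +oo[: nothing is required of, and
   nothing depends on, the values of f at negative arguments. *)
Definition degenerate_coefficient (R : realType) (f : R -> R) :=
  [/\ {within `[0, +oo[, continuous f}, f 0 = 0 & forall s, 0 < s -> 0 < f s].

(* Main.v *)
From HB Require Import structures.
Require Import Defs.
From mathcomp Require Import all_boot all_order all_algebra.
From mathcomp Require Import all_classical all_reals all_analysis.
From mathcomp Require Import measurable_realfun.
From mathcomp Require Import ring lra.
Set Implicit Arguments.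
Unset Strict Implicit.
Unset Printing Implicit Defensive.
Import Order.TTheory GRing.Theory Num.Theory.
Import numFieldNormedType.Exports.
Local Open Scope classical_set_scope.
Local Open Scope ring_scope.

(** Two test functions are used in the no-flux identities. Testing the equation of
    [w] with the constant 1 gives [\int eta(w) |grad v|^2 = 0], so the dissipation
    vanishes almost everywhere and the equation of [w] becomes
    [div (kappa(w) grad w) = 0]. One would like to test this with [w] itself, but
    [w] is only in [W^{1,1}_loc], so that neither [w] nor [grad w] is known to be
    square integrable. The remedy is a bounded [Phi] with [0 < Phi'(s) <= kappa(s)]
    for [s > 0] ([absorbing_function]): then [grad Phi(w) = Phi'(w) grad w] is
    dominated by the flux [kappa(w) grad w], which is in [L^2], so [Phi(w)] is
    admissible and gives [\int kappa(w) Phi'(w) |grad w|^2 = 0]. Since [kappa] and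
    [Phi'] vanish at 0 only, [Phi'(w) grad w = 0] even where [w = 0] (where nothing
    is said of [grad w] itself), so [Phi(w)] has weak gradient zero and is constant
    on the connected [Omega]; [Phi] is injective on [0, +oo[, so [w] is a constant
    [c >= 0] ([steady_state_w_const]). If [c = 0] the solution is trivial. If
    [c > 0], then [eta(c) > 0] and the vanishing dissipation gives [grad v = 0], so
    [v] is constant too, and the two constants are read off from the conserved
    quantities ([conserved_const]). Conversely, for both families the fluxes vanish
    almost everywhere ([steady_state_flux0]).

    Two facts on weak derivatives carry this argument: the chain rule
    ([weak_grad_comp]) and the constancy of functions with zero weak gradient
    ([weak_grad0_const]). Instead of mollification, both rest on an identity for
    translates ([translate_weak_derive]): if [g] is the weak derivative of [u] in the
    direction [e], then almost everywhere
      [u(x + e) - u(x) = \int_0^1 g(x + t e) dt].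
    It is obtained by moving the translation onto a test function, where it is the
    fundamental theorem of calculus, and undoing it by Fubini; the integrands are
    then identified by the fundamental lemma of the calculus of variations.

    When [g = 0], [u] is invariant under every small translation; by Tonelli almost
    every [x] satisfies [u(x + e) = u(x)] for almost every small [e], and one such
    [x] shows that [u] is constant near it.

    For the chain rule, the identity turns the increment of [Phi(u)] along [h e] into
    [h] times an average of [g] against difference quotients of [Phi]. After one more
    change of variables [g] stands untranslated and every translation acts on [u] or
    on the test function; along steps that decrease geometrically the translates of
    [u] converge almost everywhere ([ae_cvg_translate]), and dominated convergence
    concludes. *)

(** * Boxes and the translation invariance of the Lebesgue measure *)

Section boxes.
Context {R : realType} {n : nat}.
Notation V := ('rV[R]_n).
Implicit Types a b x : V.

Definition box a b : set V :=
  [set x | forall i, a ord0 i <= x ord0 i <= b ord0 i].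

Lemma measurable_box a b : measurable (box a b).
Proof.
rewrite (_ : box a b =
  \big[setI/setT]_(i < n) (@rV_coord R n i @^-1` [set` `[a ord0 i, b ord0 i]])).
  apply: bigsetI_measurable => i _; rewrite -[X in measurable X]setTI.
  exact: measurable_rV_coord.
apply/seteqP; split=> x /=.
  by move=> h; rewrite -bigcap_seq => i _; rewrite /= in_itv; exact: h.
rewrite -bigcap_seq => h i; have := h i; rewrite /= in_itv /=; apply.
by rewrite /= mem_index_enum.
Qed.

Lemma boxI a b a' b' : box a b `&` box a' b' =
  box (\row_i Num.max (a ord0 i) (a' ord0 i)) (\row_i Num.min (b ord0 i) (b' ord0 i)).
Proof.
apply/seteqP; split => x /=.
  move=> [h h'] i; rewrite !mxE ge_max le_min.
  by have /andP[-> ->] := h i; have /andP[-> ->] := h' i.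
move=> h; split=> i; have := h i; rewrite !mxE ge_max le_min.
  by move=> /andP[/andP[-> _] /andP[-> _]].
by move=> /andP[/andP[_ ->] /andP[_ ->]].
Qed.

Definition boxes : set (set V) := [set Q | exists a b, Q = box a b].

Lemma boxesI : setI_closed boxes.
Proof. by move=> _ _ [a [b ->]] [a' [b' ->]]; rewrite boxI; do 2 eexists. Qed.

Lemma box_exhausts : \bigcup_k box (const_mx (- k%:R)) (const_mx k%:R) = setT.
Proof.
apply/seteqP; split=> // x _.
exists (Num.trunc (\sum_i `|x ord0 i|)).+1 => // i /=; rewrite !mxE -ler_norml.
apply: (@le_trans _ _ (\sum_i `|x ord0 i|)).
  by rewrite (bigD1 i)//= lerDl sumr_ge0.
exact/ltW/truncnS_gt.
Qed.

(** Boxes form a pi-system that generates the product sigma-algebra, a half space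
    being an increasing union of boxes: measures and integrals can be compared on
    boxes only. *)
Lemma measurable_boxes : @measurable _ V = <<s boxes >>.
Proof.
apply/seteqP; split; last first.
  apply: smallest_sub; first exact: sigma_algebra_measurable.
  by move=> _ [a [b ->]]; exact: measurable_box.
move=> A mA.
pose T := g_sigma_algebraType boxes.
suff mid : measurable_fun setT (id : T -> V).
  by have := mid measurableT A mA; rewrite setTI.
apply: measurable_fun_rVP => i.
apply: (measurability _ (RGenCInfty.measurableE R)) => _ [_ [c ->] <-].
rewrite setTI.
rewrite (_ : _ @^-1` _ = \bigcup_k
   (box (\row_j if j == i then c else - k%:R) (const_mx k%:R) : set T)).
  apply: bigcupT_measurable => k; apply: sub_sigma_algebra.
  by do 2 eexists.
apply/seteqP; split => x /=; rewrite in_itv /= andbT.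
  move=> cx; have : (\bigcup_k box (const_mx (- k%:R)) (const_mx k%:R)) x.
    by rewrite box_exhausts.
  move=> [k _ h]; exists k => // j; have := h j; rewrite !mxE.
  by move=> /andP[h1 ->]; rewrite andbT; case: eqP => // ->.
by move=> [k _ /(_ i)]; rewrite !mxE eqxx => /andP[].
Qed.

Lemma lebesgue_box a b : lebesgue_rV R n (box a b) =
  if [forall i, a ord0 i <= b ord0 i]
  then (\prod_(i < n) (b ord0 i - a ord0 i))%:E else 0%E.
Proof.
case: ifPn => [/forallP ab|].
  rewrite (_ : box a b = [set x | forall i, x ord0 i \in `[a ord0 i, b ord0 i]]).
    exact: lebesgue_rV_box.
  by apply/seteqP; split => x /= h i; have := h i; rewrite in_itv.
rewrite negb_forall => /existsP[i nab].
rewrite (_ : box a b = set0) ?measure0// -subset0 => x /(_ i) /andP[h1 h2].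
by move: nab; rewrite (le_trans h1 h2).
Qed.

Lemma lebesgue_box_lty a b : (lebesgue_rV R n (box a b) < +oo)%E.
Proof. by rewrite lebesgue_box; case: ifP => _; exact: ltry. Qed.

Lemma lebesgue_rV_unique (m : {measure set V -> \bar R}) :
  (forall a b, lebesgue_rV R n (box a b) = m (box a b)) ->
  forall A, measurable A -> lebesgue_rV R n A = m A.
Proof.
move=> h A mA.
apply: (measure_unique boxes
  (fun k => box (const_mx (- k%:R)) (const_mx k%:R)) measurable_boxes boxesI) => //.
- by move=> k; do 2 eexists.
- exact: box_exhausts.
- by move=> _ [a [b ->]].
- by move=> k; exact: lebesgue_box_lty.
Qed.

Lemma sigma_finite_lebesgue_rV : sigma_finite setT (lebesgue_rV R n).
Proof.
exists (fun k => box (const_mx (- k%:R)) (const_mx k%:R)).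
  by rewrite box_exhausts.
by move=> k; split; [exact: measurable_box|exact: lebesgue_box_lty].
Qed.

Lemma measurable_addr_rV d (T : measurableType d) (f g : T -> V) :
  measurable_fun setT f -> measurable_fun setT g ->
  measurable_fun setT (fun x : T => f x + g x).
Proof.
move=> mf mg; apply: measurable_fun_rVP => i.
have -> : rV_coord i \o (fun x : T => f x + g x) =
    (rV_coord i \o f : T -> R) \+ (rV_coord i \o g).
  by apply/funext => x; rewrite /rV_coord /= mxE.
by apply: measurable_funD; apply: (measurableT_comp (measurable_rV_coord i)).
Qed.

Lemma measurable_scale_rV d (T : measurableType d) (f : T -> R) (e : V) :
  measurable_fun setT f -> measurable_fun setT (fun x : T => f x *: e : V).
Proof.
move=> mf; apply: measurable_fun_rVP => i.
have -> : rV_coord i \o (fun x : T => f x *: e) = f \* cst (e ord0 i).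
  by apply/funext => x; rewrite /rV_coord /= mxE.
exact: measurable_funM.
Qed.

Lemma measurable_translate (e : V) : measurable_fun setT (fun x : V => x + e).
Proof. by apply: measurable_addr_rV => //; exact: measurable_cst. Qed.

(** The push-forward by a translation is a measure, and it agrees with the Lebesgue
    measure on boxes because the side lengths do. *)
Lemma lebesgue_rV_translate (e : V) A : measurable A ->
  lebesgue_rV R n ((fun x => x + e) @^-1` A) = lebesgue_rV R n A.
Proof.
pose mphi := isMeasurableFun.Build _ _ _ _ _ (measurable_translate e).
pose phi : {mfun V >-> V} := HB.pack (fun x : V => x + e) mphi.
move=> mA; apply/esym.
apply: (@lebesgue_rV_unique (pushforward (lebesgue_rV R n) phi)) => // a b.
rewrite /= /pushforward /=.
rewrite (_ : _ @^-1` _ = box (a - e) (b - e)); last first.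
  apply/seteqP; split => x /= h i; have := h i; rewrite !mxE.
    by rewrite lerBlDr lerBrDr.
  by rewrite lerBlDr lerBrDr.
rewrite !lebesgue_box.
under [X in _ = if X then _ else _]eq_forallb => i do rewrite !mxE lerD2r.
case: ifP => // _; congr (_%:E); apply: eq_bigr => i _.
by rewrite !mxE; ring.
Qed.

End boxes.

(** * Real-valued integrals *)

Section real_integrals.
Context d (T : measurableType d) (R : realType) (mu : {measure set T -> \bar R}).
Implicit Types f g h : T -> R.

Lemma Rintegral_ae_eq (D : set T) f g : measurable D ->
  measurable_fun D f -> measurable_fun D g ->
  {ae mu, forall x, D x -> f x = g x} ->
  \int[mu]_(x in D) f x = \int[mu]_(x in D) g x.
Proof.
move=> mD mf mg fg; congr fine; apply: ae_eq_integral => //.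
- exact/measurable_EFinP.
- exact/measurable_EFinP.
- by apply: filterS fg => x h Dx; rewrite h.
Qed.

Lemma Rintegral0 (D : set T) : \int[mu]_(x in D) (0 : R) = 0.
Proof. by rewrite /Rintegral integral0. Qed.

Lemma integrable_mul_bounded (D : set T) f h (M : R) : measurable D ->
  mu.-integrable D (EFin \o f) -> measurable_fun D h ->
  (forall x, D x -> `|h x| <= M) ->
  mu.-integrable D (EFin \o (fun x => f x * h x)).
Proof.
move=> mD fi mh hM.
have mf : measurable_fun D f by apply/measurable_EFinP; exact: measurable_int fi.
apply: (@le_integrable _ _ _ _ _ mD _ (fun x => M%:E * (EFin \o f) x)%E).
- by apply/measurable_EFinP; exact: measurable_funM.
- move=> x Dx; rewrite /= lee_fin !normrM mulrC; apply: ler_wpM2r => //.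
  exact: le_trans (hM _ Dx) (ler_norm _).
- exact: integrableZl.
Qed.

Lemma integrable_bounded (D : set T) h (M : R) : measurable D -> (mu D < +oo)%E ->
  measurable_fun D h -> (forall x, D x -> `|h x| <= M) ->
  mu.-integrable D (EFin \o h).
Proof.
move=> mD Dfin mh hM.
have i1 : mu.-integrable D (EFin \o (cst 1 : T -> R)).
  apply/integrableP; split; first exact/measurable_EFinP.
  by under eq_integral => x _ do rewrite /= normr1; rewrite integral_cst// mul1e.
have := integrable_mul_bounded mD i1 mh hM.
by congr (integrable _ _ _); apply/funext => x /=; rewrite mul1r.
Qed.

Lemma dominated_Rintegral (D : set T) (f_ : nat -> T -> R) f g : measurable D ->
  (forall k, measurable_fun D (f_ k)) -> measurable_fun D f ->
  {ae mu, forall x, D x -> f_ k x @[k --> \oo] --> f x} ->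
  mu.-integrable D (EFin \o g) ->
  (forall k x, D x -> `|f_ k x| <= g x) ->
  \int[mu]_(x in D) f_ k x @[k --> \oo] --> \int[mu]_(x in D) f x.
Proof.
move=> mD mf_ mf f_f gi f_g.
have [] := @dominated_convergence _ _ _ mu D mD (fun k => EFin \o f_ k)
  (EFin \o f) (EFin \o g).
- by move=> k; apply/measurable_EFinP.
- exact/measurable_EFinP.
- by apply: filterS f_f => x h Dx; apply: cvg_EFin (h Dx); exact: nearW.
- by [].
- by apply: aeW => x k Dx; rewrite lee_fin; exact: f_g.
move=> fi _ h.
by apply: fine_cvg; rewrite fineK//; exact: integrable_fin_num.
Qed.

End real_integrals.

(** * Integrals and null sets under translation *)

Section translations.
Context {R : realType} {n : nat}.
Notation V := ('rV[R]_n).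
Notation mu := (lebesgue_rV R n).
Implicit Types (e : V) (f : V -> R).

Lemma ge0_integral_translate e (f : V -> \bar R) : measurable_fun setT f ->
  (forall x, 0 <= f x)%E ->
  (\int[mu]_x f (x + e)%R = \int[mu]_x f x)%E.
Proof.
move=> mf f0.
pose mphi := isMeasurableFun.Build _ _ _ _ _ (measurable_translate e).
pose phi : {mfun V >-> V} := HB.pack (fun x : V => x + e) mphi.
rewrite -[LHS](@ge0_integral_pushforward _ _ _ _ _ _ (measurable_translate e) mu setT)//.
by apply: (@eq_measure_integral _ _ _ _ mu (pushforward mu phi)) => A mA _;
  exact: lebesgue_rV_translate.
Qed.

Lemma integrable_translate e f : mu.-integrable setT (EFin \o f) ->
  mu.-integrable setT (EFin \o (fun x => f (x + e))).
Proof.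
move=> /integrableP[mf fi]; apply/integrableP; split.
  apply: (measurableT_comp mf); exact: measurable_translate.
by rewrite (@ge0_integral_translate e (fun x => `|(f x)%:E|%E))//; exact: measurableT_comp.
Qed.

Lemma Rintegral_translate e f : mu.-integrable setT (EFin \o f) ->
  \int[mu]_x f (x + e) = \int[mu]_x f x.
Proof.
move=> fi; congr fine.
pose mphi := isMeasurableFun.Build _ _ _ _ _ (measurable_translate e).
pose phi : {mfun V >-> V} := HB.pack (fun x : V => x + e) mphi.
rewrite -[LHS](@integral_pushforward _ _ _ _ _ phi (measurable_translate e)
  mu setT (EFin \o f))//.
- by apply: (@eq_measure_integral _ _ _ _ mu (pushforward mu phi)) => A mA _;
  exact: lebesgue_rV_translate.
- exact: measurable_int fi.
- exact: integrable_translate.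
Qed.

Lemma ae_translate e (P : V -> Prop) : {ae mu, forall x, P x} ->
  {ae mu, forall x, P (x + e)}.
Proof.
move=> [N [mN N0 PN]]; exists ((fun x => x + e) @^-1` N); split.
- by rewrite -[X in measurable X]setTI; exact: measurable_translate.
- by rewrite lebesgue_rV_translate.
- by move=> x h; exact: PN.
Qed.

End translations.

(** * Measurability of open and compact sets *)

Section topology.
Context {R : realType} {n : nat}.
Notation V := ('rV[R]_n).
Notation mu := (lebesgue_rV R n).
Implicit Types (x : V) (A U K : set V).

Lemma ball_rVP x (e : R) (y : V) : 0 < e ->
  ball x e y <-> forall i, `|x ord0 i - y ord0 i| < e.
Proof.
move=> e0; split=> [[_ h] i|h]; first exact: h.
by split=> // i j; rewrite ord1; exact: h.
Qed.

Lemma normr_coord_le x i : `|x ord0 i| <= `|x|.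
Proof.
rewrite [leRHS]/Num.norm /= mx_normrE.
by apply/bigmax_geP; right; exists (ord0, i).
Qed.

Lemma normr_rV_le x (e : R) : 0 <= e -> (forall i, `|x ord0 i| <= e) -> `|x| <= e.
Proof.
move=> e0 h; rewrite [leLHS]/Num.norm /= mx_normrE.
by apply/bigmax_leP; split=> // -[i j] _ /=; rewrite ord1.
Qed.

(** A countable family of closed boxes that contains a neighbourhood basis of every
    point; it replaces a countable base in measurability and covering arguments. *)
Definition rational_box (p : 'rV[rat]_n * nat) : set V :=
  box (\row_i (ratr (p.1 ord0 i) - p.2.+1%:R^-1))
      (\row_i (ratr (p.1 ord0 i) + p.2.+1%:R^-1)).

Lemma measurable_rational_box p : measurable (rational_box p).
Proof. exact: measurable_box. Qed.

Lemma rational_box_nbhs x U : nbhs x U ->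
  exists p, rational_box p x /\ rational_box p `<=` U.
Proof.
move=> /nbhs_ballP[e /= e0 xU].
(* the box has side [2 / (k + 1)], which must be less than the radius [e] *)
pose k := Num.trunc (2 / e).
have ke : 2 * k.+1%:R^-1 < e.
  have : 2 / e < k.+1%:R by exact: truncnS_gt.
  by rewrite ltr_pdivrMr// ltr_pdivrMr// mulrC.
have [t tE] : exists t : R, t = k.+1%:R^-1 by eexists.
rewrite -tE in ke.
have t0 : 0 < t by rewrite tE invr_gt0.
have q i : {q : rat | `|x ord0 i - ratr q| < t}.
  apply: cid; have /rat_in_itvoo[q] : x ord0 i - t < x ord0 i + t by lra.
  rewrite in_itv /= => /andP[h1 h2]; exists q.
  by rewrite ltr_norml; apply/andP; split; lra.
exists (\row_i (projT1 (q i)), k); split.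
  move=> i; rewrite !mxE /= -tE.
  by have := projT2 (q i); rewrite ltr_norml => /andP[h1 h2]; apply/andP; split; lra.
move=> y yb; apply: xU; apply/(ball_rVP _ _ e0) => i.
have := yb i; rewrite !mxE /= -tE => /andP[h1 h2].
have := projT2 (q i); rewrite ltr_norml => /andP[h3 h4].
by rewrite ltr_norml; apply/andP; split; lra.
Qed.

Lemma open_measurable_rV U : open U -> measurable U.
Proof.
move=> oU.
rewrite (_ : U = \bigcup_p (if `[< rational_box p `<=` U >] then rational_box p else set0)).
  apply: countable_bigcupT_measurable => // p.
  by case: ifP => _ //; exact: measurable_rational_box.
apply/seteqP; split => [x Ux|x [p _]].
  have [p [px pU]] := rational_box_nbhs (open_nbhs_nbhs (conj oU Ux)).
  by exists p => //; rewrite ifT//; exact/asboolP.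
by case: ifPn => // /asboolP pU /pU.
Qed.

Lemma closed_measurable_rV A : closed A -> measurable A.
Proof.
by move=> cA; rewrite -(setCK A); apply: measurableC; apply: open_measurable_rV;
  rewrite openC.
Qed.

Lemma compact_measurable_rV A : compact A -> measurable A.
Proof.
move=> cA; apply: closed_measurable_rV; exact: compact_closed.
Qed.

Lemma continuous_measurable_rV (f : V -> R) :
  continuous f -> measurable_fun setT f.
Proof.
move=> cf; apply: (measurability _ (RGenOpens.measurableE R)) => _ [_ [a [b ->]] <-].
rewrite setTI; apply: open_measurable_rV.
by move/continuousP : cf; apply; exact: interval_open.
Qed.

(** Lindeloef: the rational boxes on which [P] holds almost everywhere are countably
    many and cover [U]. *)
Lemma ae_of_local U (P : V -> Prop) :
  (forall x, U x -> exists2 W, nbhs x W & {ae mu, forall y, W y -> P y}) ->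
  {ae mu, forall x, U x -> P x}.
Proof.
move=> h.
pose good p := {ae mu, forall y, rational_box p y -> P y}.
have : forall k, \forall y \ae mu,
    forall p : 'rV[rat]_n * nat, unpickle k = Some p -> good p -> rational_box p y -> P y.
  move=> k; case: (unpickle k) => [p|]; last exact: aeW.
  have [gp|ngp] := pselect (good p).
    by apply: filterS gp => y hy q [<-].
  by apply: aeW => y q [<-].
move=> /ae_foralln; apply: filterS => x hx Ux.
have [W Wx WP] := h _ Ux; have [p [px pW]] := rational_box_nbhs Wx.
apply: (hx (pickle p) p) => //; first exact: pickleK.
by apply: filterS WP => y hy py; apply: hy; exact: pW.
Qed.

Lemma lebesgue_bounded_lty A : measurable A -> bounded_set A -> (mu A < +oo)%E.
Proof.
move=> mA /pinfty_ex_gt0[M M0 hM].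
apply: (le_lt_trans _ (lebesgue_box_lty (const_mx (- M)) (const_mx M))).
apply: le_measure; rewrite ?inE//; first exact: measurable_box.
move=> x Ax i; rewrite !mxE -ler_norml (le_trans (normr_coord_le _ _))//.
exact: hM.
Qed.

Lemma lebesgue_nbhs_gt0 x A : measurable A -> nbhs x A -> (0 < mu A)%E.
Proof.
move=> mA /rational_box_nbhs[p [_ pA]].
apply: (@lt_le_trans _ _ (mu (rational_box p))); last first.
  by apply: le_measure; rewrite ?inE//; exact: measurable_rational_box.
rewrite lebesgue_box ifT.
  have E (a t : R) : a + t - (a - t) = t + t by ring.
  by rewrite lte_fin prodr_gt0// => i _; rewrite !mxE E addr_gt0// invr_gt0.
by apply/forallP => i; rewrite !mxE lerD2l ge0_cp.
Qed.

End topology.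

(** * Closed neighbourhoods of compact sets *)

Section neighbourhoods.
Context {R : realType} {n : nat}.
Notation V := ('rV[R]_n).
Implicit Types (x : V) (A U K : set V).

Definition thicken K (r : R) : set V := [set x | exists2 y, K y & `|x - y| <= r].

Lemma thicken_self K r : 0 <= r -> K `<=` thicken K r.
Proof. by move=> r0 x Kx; exists x => //; rewrite subrr normr0. Qed.

Lemma compact_thicken K r : compact K -> compact (thicken K r).
Proof.
move=> cK.
have cB : compact [set z : V | `|z| <= r].
  apply: bounded_closed_compact.
    exists r; split; first exact: num_real.
    by move=> M rM z /= /le_trans; apply; exact: ltW.
  rewrite (_ : [set z : V | `|z| <= r] = @Num.norm R V @^-1` [set t | t <= r])//.
  by apply: closed_comp => [x _|]; [exact: norm_continuous|exact: closed_le].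
rewrite (_ : thicken K r = (fun p : V * V => p.1 + p.2) @` (K `*` [set z | `|z| <= r])).
  apply: continuous_compact; last exact: compact_setX.
  by apply: continuous_subspaceT => p; exact: add_continuous.
apply/seteqP; split => [x [y Ky xy]|_ [[y z] [/= Ky zr] <-]].
  by exists (y, x - y) => //=; rewrite addrC subrK.
by exists y => //; rewrite addrC addKr.
Qed.

Lemma compact_thicken_sub K U : compact K -> open U -> K `<=` U ->
  exists2 r : R, 0 < r & thicken K r `<=` U.
Proof.
move=> cK oU KU.
have /compact_near_coveringP cov := cK.
have /cov : forall x, K x -> \forall x' \near x & r \near 0^'+,
    forall z : V, `|z - x'| <= r -> U z.
  move=> x /KU Ux.
  have /nbhs_ballP[e /= e0 xU] : nbhs x U by exact: open_nbhs_nbhs.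
  exists (ball x (e / 2), [set r | r < e / 2]) => /=.
    split; first by apply: nbhsx_ballx; rewrite divr_gt0.
    by apply: nbhs_right_lt; rewrite divr_gt0.
  move=> [y r] /= [xy re] z zy; apply: xU.
  move: xy; rewrite -!ball_normE /= => xy.
  rewrite -(subrK y x) -addrA (le_lt_trans (ler_normD _ _))//.
  by rewrite (splitr e) ltrD// distrC (le_lt_trans zy).
move=> h.
have [r [r0 hr]] : exists r : R, 0 < r /\
    (K `<=` (fun x' => forall z : V, `|z - x'| <= r -> U z)).
  near (0 : R)^'+ => r; exists r; split; first by [].
  by near: r.
by exists r => // z [y Ky zy]; exact: hr zy.
Unshelve. all: end_near. Qed.

End neighbourhoods.

(** * Continuously differentiable functions *)

Section C1_functions.
Context {R : realType} {n : nat}.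
Notation V := ('rV[R]_n).
Implicit Types (x e v : V) (U : set V) (f g phi : V -> R) (P : R -> R).

(** Stated with directional derivatives rather than the gradient, so that the closure
    properties below hold one direction at a time. *)
Definition C1 f :=
  (forall x, differentiable f x) /\ (forall v, continuous ('D_v f)).

Lemma derive_grad f x v : differentiable f x -> 'D_v f x = dotv (grad f x) v.
Proof.
move=> df; rewrite deriveE// {1}(row_sum_delta v) linear_sum /dotv.
by apply: eq_bigr => i _; rewrite linearZ /= /grad mxE deriveE// mulrC.
Qed.

Lemma continuous_rV (T : topologicalType) (F : T -> V) :
  (forall i, continuous (fun t => F t ord0 i)) -> continuous F.
Proof.
move=> h t; apply/cvg_ballP => e e0.
have : \forall s \near t, forall i, ball (F t ord0 i) e (F s ord0 i).
  by apply: filter_forall => i; have /cvg_ballP := h i t; exact.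
by apply: filterS => s hs; apply/ball_rVP.
Qed.

Lemma C1_C1c U phi : C1 phi ->
  (exists K, [/\ compact K, K `<=` U & forall x, ~ K x -> phi x = 0]) ->
  C1c U phi.
Proof.
move=> [dphi cphi] hK; split => //; apply: continuous_rV => i.
by under eq_fun do rewrite /grad mxE; exact: cphi.
Qed.

Lemma C1c_C1 U phi : C1c U phi -> C1 phi.
Proof.
move=> [dphi cphi _]; split=> // v.
rewrite (_ : 'D_v phi = (fun x => dotv (grad phi x) v)); last first.
  by apply/funext => x; rewrite derive_grad.
apply: (@continuous_big R _ +%R 0 xpredT add_continuous V _
  (fun i x => grad phi x ord0 i * v ord0 i)).
move=> i _ x; apply: (@continuousM _ _ (fun x => grad phi x ord0 i) (cst (v ord0 i))).
  apply: (@continuous_comp _ _ _ (grad phi) (fun M : V => M ord0 i)).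
    exact: cphi.
  exact: coord_continuous.
exact: cst_continuous.
Qed.

Lemma C1_continuous f : C1 f -> continuous f.
Proof. by move=> [df _] x; exact: differentiable_continuous. Qed.

Lemma C1_cst (c : R) : C1 (cst c : V -> R).
Proof.
split=> [x|v x]; first exact: differentiable_cst.
by rewrite (_ : 'D_v _ = cst 0); [exact: cst_continuous|apply/funext => y; exact: derive_cst].
Qed.

Lemma C1_coord i : C1 (fun x : V => x ord0 i).
Proof.
have dc (x : V) : differentiable (fun x : V => x ord0 i : R) x.
  exact: differentiable_coord.
split=> // v x.
rewrite (_ : 'D_v _ = cst (v ord0 i)); first exact: cst_continuous.
apply/funext => y; apply/lim_near_cst => //=; near=> h.
have h0 : h != 0 by near: h; exact: nbhs_dnbhs_neq.
by rewrite !mxE addrK scalerA mulVf// scale1r.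
Unshelve. all: by end_near. Qed.

Lemma C1D f g : C1 f -> C1 g -> C1 (f \+ g).
Proof.
move=> [df cf] [dg cg]; split=> [x|v].
  exact: differentiableD.
rewrite (_ : 'D_v _ = 'D_v f \+ 'D_v g).
  by move=> x; exact: (continuousD (cf v x) (cg v x)).
by apply/funext => x; rewrite deriveD//; exact: diff_derivable.
Qed.

Lemma C1_sum I (s : seq I) (F : I -> V -> R) :
  (forall i, C1 (F i)) -> C1 (fun x => \sum_(i <- s) F i x).
Proof.
move=> h; elim: s => [|i s IH].
  by under eq_fun do rewrite big_nil; exact: C1_cst.
by under eq_fun do rewrite big_cons; exact: C1D.
Qed.

Lemma C1_comp P (dP : R -> R) f : (forall s : R, is_derive s 1 P (dP s)) -> continuous dP ->
  C1 f -> C1 (P \o f).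
Proof.
move=> hP cP [df cf].
have dPs s : differentiable P s by apply/derivable1_diffP; case: (hP s).
split=> [x|v]; first exact: differentiable_comp.
rewrite (_ : 'D_v _ = (fun x => dP (f x) * 'D_v f x)).
  move=> x; apply: continuousM (cf v x).
  apply: (@continuous_comp _ _ _ f dP) (cP _).
  exact: differentiable_continuous.
apply/funext => x; rewrite deriveE; last exact: differentiable_comp.
rewrite diff_comp//= -(deriveE _ (df x)) diff1E// /= derive1E.
by case: (hP (f x)) => _ ->; rewrite mulrC.
Qed.

Lemma derive_translate f e v x : 'D_v (fun x => f (x + e)) x = 'D_v f (x + e).
Proof. by rewrite /derive; under eq_fun do rewrite /= -addrA. Qed.

Lemma C1_translate f e : C1 f -> C1 (fun x => f (x + e)).
Proof.
move=> [df cf].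
have de (x : V) : differentiable (fun x : V => x + e) x.
  by apply: differentiableD.
split=> [x|v x]; first exact: differentiable_comp.
rewrite (_ : 'D_v _ = (fun x => 'D_v f (x + e))).
  apply: (@continuous_comp _ _ _ (fun x : V => x + e) ('D_v f)) (cf v _).
  exact: differentiable_continuous.
by apply/funext => y; exact: derive_translate.
Qed.

Lemma is_derive_line f x e (t : R) : differentiable f (x + t *: e) ->
  is_derive t 1 (fun s : R => f (x + s *: e)) ('D_e f (x + t *: e)).
Proof.
move=> /(@diff_derivable _ _ _ _ _ e) df.
have E : (fun h : R => h^-1 *: (((fun s => f (x + s *: e)) \o shift t) (h *: 1)
      - f (x + t *: e))) =
    (fun h => h^-1 *: ((f \o shift (x + t *: e)) (h *: e) - f (x + t *: e))).
  apply/funext => h /=; rewrite -[h *: 1]/(h * 1) mulr1 scalerDl.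
  by rewrite addrCA addrC -addrA.
by split; rewrite /derivable /derive /= E.
Qed.

End C1_functions.

Lemma continuous_pos_part {R : realType} : continuous (fun s : R => Num.max s 0).
Proof.
have h : continuous (id \max cst (0 : R)).
  move=> t; apply: continuous_max; first exact: cvg_id.
  exact: cst_continuous.
exact: h.
Qed.

(** * Bump functions that approximate boxes *)

Section bumps.
Context {R : realType} {n : nat}.
Notation V := ('rV[R]_n).
Notation mu := (lebesgue_rV R n).

(** Of class C^1, and zero on the nonpositive half line only: enough regularity for
    test functions of class C^1. *)
Definition sqr_pos (s : R) : R := Num.max s 0 ^+ 2.

Lemma sqr_pos_ge0 s : 0 <= sqr_pos s. Proof. exact: sqr_ge0. Qed.

Lemma sqr_pos0 s : s <= 0 -> sqr_pos s = 0.
Proof. by move=> s0; rewrite /sqr_pos max_r// expr0n. Qed.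

Lemma sqr_pos_lt s (r : R) : 0 <= r -> sqr_pos s < r ^+ 2 -> s < r.
Proof.
move=> r0; rewrite /sqr_pos; case: (leP s 0) => s0 h.
  apply: (le_lt_trans s0); rewrite lt_neqAle r0 andbT eq_sym.
  by apply: contraTneq h => ->; rewrite ltxx.
by rewrite -ltr_sqr// nnegrE ltW.
Qed.

Lemma is_derive_sqr_pos (s : R) : is_derive s 1 sqr_pos (2 * Num.max s 0).
Proof.
(* the first-order Taylor remainder, the derivative being 2-Lipschitz *)
have est (h : R) : `|sqr_pos (h + s) - sqr_pos s - 2 * Num.max s 0 * h| <= h ^+ 2.
  rewrite /sqr_pos.
  by case: (leP (h + s) 0) => hs; case: (leP s 0) => s0; rewrite ler_norml;
    apply/andP; split; nra.
have lim : (fun h : R => h^-1 *: ((sqr_pos \o shift s) (h *: 1) - sqr_pos s)) @ 0^'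
    --> 2 * Num.max s 0.
  apply/cvgrPdist_le => e e0; near=> h.
  have h0 : h != 0 by near: h; exact: nbhs_dnbhs_neq.
  rewrite -(ler_pM2l (_ : 0 < `|h|)) ?normr_gt0// -normrM.
  rewrite -[h^-1 *: _]/(h^-1 * _) /= -[h *: 1]/(h * 1) mulr1 mulrBr mulVKf//.
  rewrite distrC [h * _]mulrC (le_trans (est h))// -(real_normK (num_real h)) expr2.
  apply: ler_wpM2l => //; near: h.
  apply: dnbhs0_le => //.
split; first by apply/cvg_ex; eexists; exact: lim.
exact: cvg_lim lim.
Unshelve. all: by end_near. Qed.

Lemma continuous_dsqr_pos : continuous (fun s : R => 2 * Num.max s 0).
Proof.
by move=> s; apply: cvgMl_tmp; exact: continuous_pos_part.
Qed.

(** The squared Euclidean distance to the box, when the box is nonempty. *)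
Definition box_gap (a b x : V) : R :=
  \sum_i (sqr_pos (a ord0 i - x ord0 i) + sqr_pos (x ord0 i - b ord0 i)).

(** Equal to 1 on the box and to 0 where the distance to it is at least [k^{-1/2}];
    as [k] grows these functions decrease to the indicator of the box. *)
Definition bump (a b : V) (k : nat) (x : V) : R :=
  sqr_pos (1 - k%:R * box_gap a b x).

Lemma box_gap_ge0 a b x : 0 <= box_gap a b x.
Proof. by apply: sumr_ge0 => i _; rewrite addr_ge0 ?sqr_pos_ge0. Qed.

Lemma box_gap_eq0 a b x : box a b x -> box_gap a b x = 0.
Proof.
move=> h; rewrite /box_gap big1// => i _; have /andP[h1 h2] := h i.
by rewrite !sqr_pos0 ?addr0// subr_le0.
Qed.

Lemma box_gap_lt a b x r : 0 <= r -> box_gap a b x < r ^+ 2 ->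
  forall i, a ord0 i - r < x ord0 i < b ord0 i + r.
Proof.
move=> r0 h i; move: h; rewrite /box_gap (bigD1 i)//=.
set s := \sum_(j < n | _) _; have s0 : 0 <= s.
  by apply: sumr_ge0 => j _; rewrite addr_ge0 ?sqr_pos_ge0.
have h1 := sqr_pos_ge0 (a ord0 i - x ord0 i).
have h2 := sqr_pos_ge0 (x ord0 i - b ord0 i).
move=> h; have {h1 h2} [h1 h2] : a ord0 i - x ord0 i < r /\ x ord0 i - b ord0 i < r.
  split; apply: sqr_pos_lt => //; apply: le_lt_trans h.
    by rewrite -addrA lerDl addr_ge0.
  by rewrite addrAC lerDr addr_ge0.
by rewrite ltrBlDr -ltrBlDl h1 -ltrBlDl h2.
Qed.

Lemma C1_sqr_pos (f : V -> R) : C1 f -> C1 (fun x => sqr_pos (f x)).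
Proof. exact: (C1_comp is_derive_sqr_pos continuous_dsqr_pos). Qed.

Lemma C1_affine (f : V -> R) (c m : R) : C1 f -> C1 (fun x => c + m * f x).
Proof.
move=> cf; apply: (C1D (C1_cst c)).
apply: (@C1_comp _ _ ( *%R m) (cst m)) => //; last exact: cst_continuous.
move=> s; rewrite (_ : *%R m = m \*: id); last by apply/funext.
by apply: is_derive_eq; rewrite -[m *: 1]/(m * 1) mulr1.
Qed.

Lemma C1_bump a b k : C1 (bump a b k).
Proof.
apply: C1_sqr_pos; rewrite (_ : (fun x => _) =
  (fun x => 1 + (- k%:R) * box_gap a b x)); last by apply/funext => x; ring.
apply: C1_affine; apply: C1_sum => i; apply: C1D; apply: C1_sqr_pos.
  rewrite (_ : (fun x => _) = (fun x : V => a ord0 i + (-1) * x ord0 i)).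
    exact/C1_affine/C1_coord.
  by apply/funext => x; ring.
rewrite (_ : (fun x => _) = (fun x : V => - b ord0 i + 1 * x ord0 i)).
  exact/C1_affine/C1_coord.
by apply/funext => x; ring.
Qed.

Lemma bump_bound a b k x : `|bump a b k x| <= 1.
Proof.
rewrite ger0_norm ?sqr_pos_ge0// /bump /sqr_pos expr_le1//.
  rewrite ge_max ler01 andbT lerBlDr lerDl mulr_ge0 ?box_gap_ge0//.
by rewrite le_max lexx orbT.
Qed.

Lemma bump_cvg a b k0 x :
  bump a b (k + k0) x @[k --> \oo] --> (\1_(box a b) x : R).
Proof.
rewrite indicE; case: (boolP (x \in box a b)); rewrite ?inE ?notin_setE => xab.
  apply: cvg_near_cst; apply: nearW => k.
  by rewrite /bump box_gap_eq0// mulr0 subr0 /sqr_pos max_l// expr1n.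
have gap0 : 0 < box_gap a b x.
  rewrite lt_neqAle box_gap_ge0 andbT eq_sym; apply/negP => /eqP h0; apply: xab => i.
  have g0 : box_gap a b x <= 0 by rewrite h0.
  have/andP[h1 h2] : a ord0 i <= x ord0 i <= b ord0 i; last by rewrite h1 h2.
  by apply/andP; split; apply/ler_addgt0Pr => e e0;
    have /(box_gap_lt (ltW e0))/(_ i)/andP[] : box_gap a b x < e ^+ 2;
    rewrite ?h0 ?exprn_gt0//; lra.
apply: cvg_near_cst; near=> k; apply: sqr_pos0.
rewrite subr_le0 -ler_pdivrMr// mul1r.
apply: (@le_trans _ _ k%:R); last by rewrite ler_nat leq_addr.
by near: k; exact: nbhs_infty_ger.
Unshelve. all: by end_near. Qed.

(** A box inside an open set keeps a positive distance [r] to its complement, so its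
    bumps are supported in the open set once [k > r^{-2}]. *)
Lemma bump_C1c (a b : V) (U : set V) : open U -> (forall i, a ord0 i <= b ord0 i) ->
  box a b `<=` U -> exists k0, forall k, C1c U (bump a b (k + k0)).
Proof.
move=> oU ab abU.
have cQ : compact (box a b).
  rewrite (_ : box a b = [set x | forall i, `[a ord0 i, b ord0 i]%classic (x ord0 i)]).
    by apply: (@rV_compact R _ (fun i => `[a ord0 i, b ord0 i]%classic)) => i;
      exact: segment_compact.
  by apply/seteqP; split => x h i; have := h i; rewrite /= in_itv.
have [r r0 hr] := compact_thicken_sub cQ oU abU.
exists (Num.truncn (r ^- 2)).+1 => k; apply: C1_C1c; first exact: C1_bump.
exists (thicken (box a b) r); split => //; first exact: compact_thicken.
move=> x nx; apply: sqr_pos0; rewrite subr_le0 leNgt; apply/negP => h.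
apply: nx.
have {h} /(box_gap_lt (ltW r0)) h : box_gap a b x < r ^+ 2.
  rewrite -(ltr_pM2l (_ : 0 < (k + (Num.truncn (r ^- 2)).+1)%:R :> R)) ?ltr0n ?addnS//.
  rewrite -addnS; apply: (lt_le_trans h).
  rewrite -ler_pdivrMr ?exprn_gt0// mul1r.
  apply: ltW; apply: (lt_le_trans (truncnS_gt _)).
  by rewrite ler_nat leq_addl.
(* the projection of [x] onto the box *)
exists (\row_i Num.max (a ord0 i) (Num.min (x ord0 i) (b ord0 i))).
  by move=> i; rewrite mxE le_max lexx /= ge_max ab /= ge_min lexx orbT.
apply: normr_rV_le; first exact: ltW.
move=> i; rewrite !mxE; have /andP[h1 h2] := h i; have := ab i => abi.
rewrite ler_norml.
by case: (leP (x ord0 i) (b ord0 i)) => hb; case: (leP (a ord0 i) _) => ha;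
  apply/andP; split; lra.
Qed.

End bumps.

(** * The fundamental lemma of the calculus of variations *)

Section fundamental_lemma.
Context {R : realType} {n : nat}.
Notation V := ('rV[R]_n).
Notation mu := (lebesgue_rV R n).

Lemma integral_box_eq0 (U : set V) (f : V -> R) (a b : V) : open U ->
  mu.-integrable setT (EFin \o f) ->
  (forall psi, C1c U psi -> \int[mu]_x (f x * psi x) = 0) ->
  box a b `<=` U -> (\int[mu]_(x in box a b) (f x)%:E = 0)%E.
Proof.
move=> oU fi h abU.
case: (boolP [forall i, a ord0 i <= b ord0 i]) => [/forallP ab|]; last first.
  rewrite negb_forall => /existsP[i nab].
  rewrite (_ : box a b = set0) ?integral_set0// -subset0 => x /(_ i) /andP[h1 h2].
  by move: nab; rewrite (le_trans h1 h2).
have [k0 hk] := bump_C1c oU ab abU.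
have mf : measurable_fun setT f by apply/measurable_EFinP; exact: measurable_int fi.
have mb k : measurable_fun setT (bump a b k).
  by apply: continuous_measurable_rV; apply: C1_continuous; exact: C1_bump.
have lim : \int[mu]_x (f x * bump a b (k + k0) x) @[k --> \oo] -->
    \int[mu]_x (f x * \1_(box a b) x).
  apply: (@dominated_Rintegral _ _ _ _ _ (fun k x => f x * bump a b (k + k0) x)
    _ (fun x => `|f x|)) => //.
  - by move=> k; exact: measurable_funM.
  - apply: measurable_funM => //; apply: measurable_indic; exact: measurable_box.
  - apply: aeW => x _; apply: cvgMl_tmp; exact: bump_cvg.
  - by have /integrable_abse := fi.
  - by move=> k x _; rewrite normrM ler_piMr// bump_bound.
have E : (fun k => \int[mu]_x (f x * bump a b (k + k0) x)) = cst 0.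
  by apply/funext => k; exact: h.
have I0 : \int[mu]_x (f x * \1_(box a b) x) = 0.
  by rewrite E in lim; exact: cvg_unique lim (cvg_cst 0).
rewrite -[LHS]fineK; last first.
  apply: integrable_fin_num; first exact: measurable_box.
  by apply: integrableS fi => //; exact: measurable_box.
congr EFin; rewrite -[RHS]I0 -[LHS]/(\int[mu]_(x in box a b) f x) Rintegral_mkcond.
apply: eq_Rintegral => x _; rewrite patchE indicE.
by case: ifPn => _; rewrite ?mulr1 ?mulr0.
Qed.

(** The sets on which [f] has integral zero within the box contain all boxes, by the
    approximation by bumps, and they form a Dynkin system; so they are all
    measurable sets, and [f] vanishes. *)
Lemma box_ae_eq0 (U : set V) (f : V -> R) (a b : V) : open U ->
  mu.-integrable setT (EFin \o f) ->
  (forall psi, C1c U psi -> \int[mu]_x (f x * psi x) = 0) ->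
  box a b `<=` U -> {ae mu, forall x, box a b x -> f x = 0}.
Proof.
move=> oU fi h abU.
have mB := measurable_box a b.
have fS S : measurable S -> mu.-integrable S (EFin \o f).
  by move=> mS; apply: integrableS fi.
have I0 S : measurable S -> (\int[mu]_(x in S `&` box a b) (f x)%:E = 0)%E.
  move=> mS.
  apply: (@dynkin_induction _ V boxes
    (fun S => \int[mu]_(x in S `&` box a b) (f x)%:E = 0)%E) => //.
  - exact: measurable_boxes.
  - exact: boxesI.
  - by rewrite setTI; exact: integral_box_eq0 abU.
  - move=> _ [a' [b' ->]] /=; rewrite boxI; apply: (integral_box_eq0 oU) => //.
    by rewrite -boxI => x [_ /abU].
  - move=> A mA A0.
    have /= := @integral_setU _ _ _ mu (A `&` box a b) (~` A `&` box a b) (EFin \o f).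
    rewrite -setIUl setUv setTI A0 add0e => <-.
    + exact: integral_box_eq0 abU.
    + exact: measurableI.
    + by apply: measurableI => //; exact: measurableC.
    + exact: measurable_int (fS _ mB).
    + apply/disj_setPS => x [[Ax _] [nAx _]]; exact: nAx.
  - move=> F mF tF F0; rewrite setI_bigcupl integral_bigcup.
    + by rewrite eseries0// => i _ _; exact: F0.
    + exact: trivIset_setIr.
    + by move=> k; exact: measurableI.
    + by apply: fS; apply: bigcupT_measurable => k; exact: measurableI.
  - by rewrite -measurable_boxes.
have : ae_eq mu (box a b) (EFin \o f) (cst 0%E).
  apply: (integral_ae_eq mB) => //; first exact: fS.
  move=> E EB mE; rewrite integral0.
  by rewrite -[RHS](I0 _ mE) setIidl.
by apply: filterS => x hx /hx [].
Qed.

(** It suffices to argue near each point, inside a box contained in [U]. *)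
Theorem fundamental_lemma (U : set V) (f : V -> R) : open U ->
  mu.-integrable setT (EFin \o f) ->
  (forall psi, C1c U psi -> \int[mu]_x (f x * psi x) = 0) ->
  {ae mu, forall x, U x -> f x = 0}.
Proof.
move=> oU fi h; apply: ae_of_local => x Ux.
have /nbhs_ballP[e /= e0 xU] : nbhs x U by exact: open_nbhs_nbhs.
exists (ball x (e / 2)); first by apply: nbhsx_ballx; rewrite divr_gt0.
have e20 : 0 < e / 2 by rewrite divr_gt0.
suff : {ae mu, forall y, box (\row_i (x ord0 i - e / 2)) (\row_i (x ord0 i + e / 2)) y ->
    f y = 0}.
  apply: filterS => y hy /(ball_rVP _ _ e20) xy; apply: hy => i; rewrite !mxE.
  by have := xy i; rewrite ltr_norml => /andP[h1 h2]; apply/andP; split; lra.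
apply: box_ae_eq0 oU fi h _ => y xy; apply: xU; apply/(ball_rVP _ _ e0) => i.
have := xy i; rewrite !mxE => /andP[h1 h2].
by rewrite ltr_norml; apply/andP; split; lra.
Qed.

End fundamental_lemma.

(** * Fubini's theorem for averages over the unit interval *)

Section fubini_unit.
Context {R : realType} d (T : measurableType d)
  (m : {sigma_finite_measure set T -> \bar R}).
Notation leb := (@lebesgue_measure R).
Variables (k : R -> T -> R) (M : R).
Hypothesis mk : measurable_fun setT (fun p : measurableTypeR R * T => k p.1 p.2).
Hypothesis kM : forall t, 0 <= t <= 1 -> (\int[m]_x `|(k t x)%:E| <= M%:E)%E.

(** Fubini's theorem is about the whole product space: the kernel is cut off outside
    the unit interval. *)
Let K (p : measurableTypeR R * T) := (k p.1 p.2 * \1_(`[0, 1]%classic) p.1)%:E.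

Let mK : measurable_fun setT K.
Proof.
apply/measurable_EFinP; apply: measurable_funM => //.
by apply: measurableT_comp => //; apply: measurable_indic; exact: measurable_itv.
Qed.

Let int_abs_K t : (\int[m]_x `|K (t, x)| <= M%:E * (\1_(`[0, 1]%classic) t)%:E)%E.
Proof.
rewrite /K /= indicE; case: (boolP (t \in _)) => /=.
  rewrite inE /= in_itv /= mule1 => t01.
  by under eq_integral do rewrite mulr1; exact: kM.
by move=> _; under eq_integral do rewrite mulr0 normr0; rewrite integral0 mule0.
Qed.

Let M0 : 0 <= M.
Proof.
rewrite -lee_fin; apply: le_trans (kM (t := 0) _); last by rewrite lexx ler01.
exact: integral_ge0.
Qed.

Let int_indic01 : (\int[leb]_t (M%:E * (\1_(`[0, 1]%classic) t)%:E) = M%:E)%E.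
Proof.
rewrite ge0_integralZl//=.
- rewrite integral_indic// setIT.
  rewrite [X in (_ * X)%E](lebesgue_measure_itv `[0, 1]) /= lte_fin ltr01.
  by rewrite -EFinB subr0 mule1.
- by apply/measurable_EFinP; apply: measurable_indic; exact: measurable_itv.
Qed.

Let int_abs_int_K : (\int[leb]_t \int[m]_x `|K (t, x)| <= M%:E)%E.
Proof.
rewrite -int_indic01; apply: ge0_le_integral => //.
- by move=> t _; exact: integral_ge0.
- apply: (measurable_fun_fubini_tonelli_F (abse \o K)).
    exact: measurableT_comp.
  by move=> p; exact: abse_ge0.
- apply: emeasurable_funM => //; apply/measurable_EFinP.
  by apply: measurable_indic; exact: measurable_itv.
Qed.

Let iK : (leb \x m)%E.-integrable setT K.
Proof. by apply/integrable12ltyP => //; exact: le_lt_trans (ltry M). Qed.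

Let restrictE x : (fun t => k t x * \1_(`[0, 1]%classic) t) =
  (fun t => k t x) \_ `[0, 1]%classic.
Proof.
apply/funext => t; rewrite patchE indicE.
by case: ifPn => _; rewrite ?mulr1 ?mulr0.
Qed.

Let G x := (\int[leb]_t K (t, x))%E.

Let fineG x : fine (G x) = \int[leb]_(t in `[0, 1]) k t x.
Proof. by rewrite [RHS]Rintegral_mkcond -restrictE. Qed.

Let mG : measurable_fun setT G.
Proof. exact: measurable_fubini_G iK. Qed.

Let int_abs_G : (\int[m]_x `|G x| <= M%:E)%E.
Proof.
apply: (@le_trans _ _ (\int[m]_x \int[leb]_t `|K (t, x)|)%E).
  apply: ge0_le_integral => //.
  - exact: measurableT_comp.
  - apply: (measurable_fun_fubini_tonelli_G (abse \o K)).
      exact: measurableT_comp.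
    by move=> p; exact: abse_ge0.
  - move=> x _; apply: le_abse_integral => //.
    by apply: (measurableT_comp mK); exact: measurable_pair2.
have mK' : measurable_fun setT (abse \o K) by exact: measurableT_comp.
have K0 p : (0 <= (abse \o K) p)%E by exact: abse_ge0.
by rewrite -[leLHS](fubini_tonelli _ mK' K0).
Qed.

Let iG : m.-integrable setT G.
Proof. by apply/integrableP; split=> //; exact: le_lt_trans (ltry M). Qed.

Lemma ae_integrable_unit :
  {ae m, forall x, leb.-integrable `[0, 1] (fun t => (k t x)%:E)}.
Proof.
apply: filterS (ae_integrable2 iK) => x ix.
have mI : measurable (`[0, 1]%classic : set (measurableTypeR R)).
  exact: measurable_itv.
apply/(integrable_mkcond _ mI).
rewrite (_ : _ \_ _ = fun t => K (t, x))//.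
apply/funext => t; rewrite /K /= patchE indicE.
by case: ifPn => _; rewrite ?mulr1 ?mulr0.
Qed.

Let ae_fin : {ae m, forall x, G x = (\int[leb]_(t in `[0, 1]) k t x)%:E}.
Proof.
apply: filterS (integrable_ae measurableT iG) => x /(_ I) fx.
by rewrite -fineG fineK.
Qed.

Let measurable_unit : measurable_fun setT (fun x => \int[leb]_(t in `[0, 1]) k t x).
Proof.
under eq_fun do rewrite -fineG.
by apply: measurableT_comp => //; exact: measurable_int iG.
Qed.

Lemma integrable_unit :
  m.-integrable setT (fun x => (\int[leb]_(t in `[0, 1]) k t x)%:E).
Proof.
apply: (le_integrable measurableT _ _ iG); first exact/measurable_EFinP.
by move=> x _; rewrite -fineG; case: (G x) => [r||] //=; rewrite normr0 le0y.
Qed.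

Lemma fubini_unit : \int[leb]_(t in `[0, 1]) \int[m]_x k t x =
  \int[m]_x \int[leb]_(t in `[0, 1]) k t x.
Proof.
transitivity (fine (\int[leb]_t \int[m]_x K (t, x))); last first.
  rewrite (Fubini iK); congr fine; apply: ae_eq_integral => //.
  - exact/measurable_EFinP.
  - by apply: filterS ae_fin.
rewrite Rintegral_mkcond; congr fine; apply: eq_integral => t _.
rewrite patchE; case: ifPn.
  rewrite inE /= in_itv /= => t01.
  rewrite /Rintegral fineK.
    apply: eq_integral => x _; rewrite /K /= indicE mem_set ?mulr1//=.
  apply: integrable_fin_num => //; apply/integrableP; split.
    apply/measurable_EFinP.
    exact: (measurableT_comp mk (measurable_pair1 (t : measurableTypeR R))).
  by apply: le_lt_trans (ltry M); exact: kM.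
rewrite notin_setE => t01; rewrite /K /= indicE memNset//.
by under eq_integral do rewrite mulr0; rewrite integral0.
Qed.

Lemma measurable_unit_l :
  measurable_fun (`[0, 1]%classic : set (measurableTypeR R)) (fun t => \int[m]_x k t x).
Proof.
apply: (@eq_measurable_fun _ _ (measurableTypeR R) (measurableTypeR R) _
  (fun t => fine (\int[m]_x K (t, x)))).
  move=> t; rewrite inE /= in_itv /= => t01; congr fine.
  by apply: eq_integral => x _; rewrite /K /= indicE mem_set ?mulr1//= in_itv.
apply: measurable_funTS; apply: measurableT_comp => //.
exact: measurable_fubini_F iK.
Qed.

Lemma le_integral_unit :
  (\int[m]_x `|(\int[leb]_(t in `[0, 1]) k t x)%:E| <= M%:E)%E.
Proof.
apply: le_trans int_abs_G; apply: ge0_le_integral => //.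
- by apply: measurableT_comp => //; exact/measurable_EFinP.
- exact: measurableT_comp.
- by move=> x _; rewrite -fineG; case: (G x) => [r||] //=; rewrite normr0 le0y.
Qed.

End fubini_unit.

(** * The Lebesgue measure as a sigma-finite measure *)

Section sigma_finite.
Context (R : realType) (n : nat).

(** A name for the Lebesgue measure to which the sigma-finite structure can be
    attached: the measure itself is defined by recursion on the dimension, so its
    head symbol varies. *)
Definition sigma_finite_lebesgue : set 'rV[R]_n -> \bar R := lebesgue_rV R n.

HB.instance Definition _ := isMeasure.Build _ _ _ sigma_finite_lebesgue
  (measure0 (lebesgue_rV R n)) (measure_ge0 (lebesgue_rV R n))
  (@measure_semi_sigma_additive _ _ _ (lebesgue_rV R n)).

HB.instance Definition _ := @Measure_isSigmaFinite.Build _ _ _ sigma_finite_lebesgue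
  sigma_finite_lebesgue_rV.

End sigma_finite.

(** * Integrability along segments *)

Section lebesgue_fubini.
Context {R : realType} {n : nat}.
Notation V := ('rV[R]_n).
Notation mu := (lebesgue_rV R n).
Notation leb := (@lebesgue_measure R).

Lemma measurable_line (f : V -> R) (e : V) : measurable_fun setT f ->
  measurable_fun setT (fun p : measurableTypeR R * V => f (p.2 + p.1 *: e)).
Proof.
move=> mf; apply: (measurableT_comp mf).
apply: measurable_addr_rV; first exact: measurable_snd.
by apply: measurable_scale_rV; exact: measurable_fst.
Qed.

Lemma integral_abs_translate (f h : V -> R) (e : V) (M : R) :
  mu.-integrable setT (EFin \o f) -> measurable_fun setT h ->
  (forall x, `|h x| <= M) ->
  (\int[mu]_x `|(f (x + e)%R * h x)%:E| <= (M * \int[mu]_x `|f x|)%:E)%E.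
Proof.
move=> fi mh hM.
have mf : measurable_fun setT f by apply/measurable_EFinP; exact: measurable_int fi.
have mfe : measurable_fun setT (fun x : V => f (x + e)).
  by apply: (measurableT_comp mf); exact: measurable_translate.
have M0 : 0 <= M by exact: le_trans (hM 0).
rewrite EFinM /Rintegral fineK; last first.
  by apply: integrable_fin_num => //; exact: (integrable_abse fi).
rewrite -(@ge0_integral_translate _ _ e (fun x => `|(f x)%:E|%E)); last 2 first.
- by apply: measurableT_comp => //; exact/measurable_EFinP.
- by move=> x; exact: abse_ge0.
rewrite -ge0_integralZl//.
- apply: ge0_le_integral => //.
  + by apply: measurableT_comp => //; apply/measurable_EFinP; exact: measurable_funM.
  + by apply: emeasurable_funM => //; apply: measurableT_comp => //; exact/measurable_EFinP.
  + by move=> x _; rewrite /= lee_fin normrM mulrC ler_wpM2r.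
- by apply: measurableT_comp => //; exact/measurable_EFinP.
Qed.

End lebesgue_fubini.

(** * Test functions *)

Section test_functions.
Context {R : realType} {n : nat}.
Notation V := ('rV[R]_n).
Notation mu := (lebesgue_rV R n).
Notation leb := (@lebesgue_measure R).
Implicit Types (U C K : set V) (psi : V -> R) (e : V).

Lemma continuous_compact_support_bounded (f : V -> R) K : compact K ->
  continuous f -> (forall x, ~ K x -> f x = 0) -> exists M, forall x, `|f x| <= M.
Proof.
move=> cK cf f0.
have cfK : compact (f @` K) by apply: continuous_compact => //; exact: continuous_subspaceT.
have /pinfty_ex_gt0[M M0 hM] := compact_bounded cfK.
exists M => x; have [Kx|/f0->] := pselect (K x); first by apply: hM; exists x.
by rewrite normr0 ltW.
Qed.

Lemma derive_support psi K e : compact K -> (forall x, ~ K x -> psi x = 0) ->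
  forall x, ~ K x -> 'D_e psi x = 0.
Proof.
move=> cK p0 x nKx.
have oK : open (~` K) by rewrite openC; exact: compact_closed.
have nK : \forall y \near x, psi y = cst 0 y.
  by apply: (@filterS _ _ _ (~` K)); [exact: p0|exact: open_nbhs_nbhs].
have -> : 'D_e psi x = 'D_e (cst 0) x by exact: near_eq_derive.
exact: derive_cst.
Qed.

Lemma C1c_bounded U psi : C1c U psi -> exists M, forall x, `|psi x| <= M.
Proof.
move=> h; have /C1_continuous c := C1c_C1 h; case: h => _ _ [K [cK _ p0]].
exact: continuous_compact_support_bounded c p0.
Qed.

Lemma C1c_derive_bounded U psi e : C1c U psi -> exists M, forall x, `|'D_e psi x| <= M.
Proof.
move=> h; have [_ c] := C1c_C1 h; case: h => _ _ [K [cK _ p0]].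
apply: (continuous_compact_support_bounded cK (c e)) => x.
exact: derive_support.
Qed.

Lemma C1c_measurable U psi : C1c U psi -> measurable_fun setT psi.
Proof. by move=> /C1c_C1/C1_continuous; exact: continuous_measurable_rV. Qed.

Lemma C1c_derive_measurable U psi e : C1c U psi -> measurable_fun setT ('D_e psi).
Proof. by move=> /C1c_C1[_ /(_ e)]; exact: continuous_measurable_rV. Qed.

Lemma C1c_sub U C psi : U `<=` C -> C1c U psi -> C1c C psi.
Proof.
move=> UC [? ? [K [? KU ?]]]; split=> //; exists K; split=> //.
exact: subset_trans UC.
Qed.

Lemma C1c_translate U C psi e : C1c U psi -> (forall x, U x -> C (x - e)) ->
  C1c C (fun x : V => psi (x + e)).
Proof.
move=> h UC; apply: C1_C1c; first exact/C1_translate/(C1c_C1 h).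
have [_ _ [K [cK KU p0]]] := h.
exists ((fun x : V => x - e) @` K); split.
- apply: continuous_compact => //; apply: continuous_subspaceT => x.
  by apply: differentiable_continuous; apply: differentiableD.
- by move=> _ [x /KU/UC Cx <-].
- by move=> x nx; apply: p0 => Kx; apply: nx; exists (x + e) => //; rewrite addrK.
Qed.

Lemma deriveNd psi e x : differentiable psi x -> 'D_(- e) psi x = - 'D_e psi x.
Proof.
move=> dp; rewrite !derive_grad// /dotv -sumrN.
by apply: eq_bigr => i _; rewrite [(- e) _ _]mxE mulrN.
Qed.

Lemma deriveZd psi e (s : R) x : differentiable psi x ->
  'D_(s *: e) psi x = s * 'D_e psi x.
Proof.
move=> dp; rewrite !derive_grad// /dotv mulr_sumr.
by apply: eq_bigr => i _; rewrite [(s *: e) _ _]mxE mulrCA.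
Qed.

Lemma continuous_line (f : V -> R) e x : continuous f ->
  continuous (fun t : R => f (x + t *: e)).
Proof.
move=> cf t; apply: (@continuous_comp _ _ _ (fun t : R => x + t *: e) f); last exact: cf.
by apply: cvgD; [exact: cvg_cst|apply: cvgZr_tmp; exact: cvg_id].
Qed.

Lemma FTC_line psi e x : C1 psi ->
  \int[leb]_(t in `[0, 1]) 'D_e psi (x + t *: e) = psi (x + e) - psi x.
Proof.
move=> [dp cp].
rewrite /Rintegral (@continuous_FTC2 _ _ (fun t : R => psi (x + t *: e)) 0 1)//.
- by rewrite scale1r scale0r addr0.
- by apply: continuous_subspaceT; exact: (@continuous_line _ e x (cp e)).
- have cl : continuous (fun t : R => psi (x + t *: e)).
    by apply: continuous_line => y; exact: differentiable_continuous.
  split.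
  + by move=> t _; have [] := is_derive_line (dp (x + t *: e)).
  + exact: (cvg_at_right_filter (cl 0)).
  + exact: (cvg_at_left_filter (cl 1)).
- by move=> t _; rewrite derive1E; have [_ ->] := is_derive_line (dp (x + t *: e)).
Qed.

End test_functions.

(** * Averages along segments *)

Section line_averages.
Context {R : realType} {n : nat}.
Notation V := ('rV[R]_n).
Notation mu := (lebesgue_rV R n).
Notation leb := (@lebesgue_measure R).
Implicit Types (g H : V -> R) (e : V).

Definition line_average g e (x : V) : R := \int[leb]_(t in `[0, 1]) g (x + t *: e).

Lemma integrable_measurable g : mu.-integrable setT (EFin \o g) -> measurable_fun setT g.
Proof. by move=> gi; apply/measurable_EFinP; exact: measurable_int gi. Qed.

Let le_int g e t : mu.-integrable setT (EFin \o g) ->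
  (\int[mu]_x `|(g (x + t *: e)%R)%:E| <= (\int[mu]_x `|g x|)%:E)%E.
Proof.
move=> gi.
have := @integral_abs_translate _ _ g (cst 1) (t *: e) 1 gi.
rewrite mul1r; under eq_integral do rewrite mulr1.
by apply => [|x]; [exact: measurable_cst|rewrite normr1].
Qed.

Lemma integrableM_bounded g H (M : R) : mu.-integrable setT (EFin \o g) ->
  measurable_fun setT H -> (forall x, `|H x| <= M) ->
  mu.-integrable setT (EFin \o (fun x => g x * H x)).
Proof.
by move=> gi mH HM; apply: (integrable_mul_bounded measurableT gi mH) => x _; exact: HM.
Qed.

Lemma ae_integrable_line g e : mu.-integrable setT (EFin \o g) ->
  {ae mu, forall x, leb.-integrable `[0, 1] (fun t => (g (x + t *: e))%:E)}.
Proof.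
move=> gi; have mk := measurable_line e (integrable_measurable gi).
exact: (@ae_integrable_unit _ _ _ (@sigma_finite_lebesgue R n)
  (fun t x => g (x + t *: e)) _ mk (fun t _ => le_int e t gi)).
Qed.

Lemma integrable_line_average g e : mu.-integrable setT (EFin \o g) ->
  mu.-integrable setT (EFin \o line_average g e).
Proof.
move=> gi; have mk := measurable_line e (integrable_measurable gi).
exact: (@integrable_unit _ _ _ (@sigma_finite_lebesgue R n)
  (fun t x => g (x + t *: e)) _ mk (fun t _ => le_int e t gi)).
Qed.

Lemma le_integral_line_average g e : mu.-integrable setT (EFin \o g) ->
  (\int[mu]_x `|(line_average g e x)%:E| <= (\int[mu]_x `|g x|)%:E)%E.
Proof.
move=> gi; have mk := measurable_line e (integrable_measurable gi).
exact: (@le_integral_unit _ _ _ (@sigma_finite_lebesgue R n)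
  (fun t x => g (x + t *: e)) _ mk (fun t _ => le_int e t gi)).
Qed.

Lemma fubini_line_average g H e (M : R) : mu.-integrable setT (EFin \o g) ->
  measurable_fun setT H -> (forall x, `|H x| <= M) ->
  \int[leb]_(t in `[0, 1]) \int[mu]_x (g (x + t *: e) * H x) =
  \int[mu]_x (line_average g e x * H x).
Proof.
move=> gi mH HM.
have mg := integrable_measurable gi.
have mk : measurable_fun setT
    (fun p : measurableTypeR R * V => g (p.2 + p.1 *: e) * H p.2).
  apply: measurable_funM; first exact: measurable_line.
  by apply: measurableT_comp => //; exact: measurable_snd.
have kM t : 0 <= t <= 1 -> (\int[mu]_x `|(g (x + t *: e)%R * H x)%:E| <=
    (M * \int[mu]_x `|g x|)%:E)%E.
  by move=> _; exact: integral_abs_translate.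
rewrite (@fubini_unit _ _ _ (@sigma_finite_lebesgue R n)
  (fun t x => g (x + t *: e) * H x) _ mk kM).
apply: Rintegral_ae_eq => //.
- apply/measurable_EFinP; apply: measurable_int.
  exact: (@integrable_unit _ _ _ (@sigma_finite_lebesgue R n)
    (fun t x => g (x + t *: e) * H x) _ mk kM).
- apply: measurable_funM => //; apply: integrable_measurable.
  exact: integrable_line_average.
- apply: filterS (ae_integrable_line e gi) => x ix _.
  by rewrite /line_average -RintegralZr.
Qed.

End line_averages.

(** * Weak directional derivatives and translations *)

Section weak_derivatives.
Context {R : realType} {n : nat}.
Notation V := ('rV[R]_n).
Notation mu := (lebesgue_rV R n).
Notation leb := (@lebesgue_measure R).
Implicit Types (u g : V -> R) (e : V) (C U : set V).

(** Functions integrable on the whole space but tested in [C] only: extending by zero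
    the restriction of a locally integrable function to a compact set [C] gives such
    a pair, and its translates need no domain. *)
Definition weak_derive C e u g :=
  [/\ mu.-integrable setT (EFin \o u), mu.-integrable setT (EFin \o g) &
      forall psi, C1c C psi ->
        \int[mu]_x (u x * 'D_e psi x) = - \int[mu]_x (g x * psi x)].

Lemma weak_deriveZ C e u g s : weak_derive C e u g ->
  weak_derive C (s *: e) u (fun x => s * g x).
Proof.
move=> [ui gi h]; split => //.
  by have := integrableZl measurableT s gi.
move=> psi cpsi; have [dpsi _ _] := cpsi.
under eq_Rintegral do rewrite deriveZd// mulrCA.
under [in RHS]eq_Rintegral do rewrite -mulrA.
rewrite !RintegralZl//.
- by rewrite h// mulrN.
- have [M hM] := C1c_derive_bounded e cpsi.
  exact: (integrableM_bounded ui (C1c_derive_measurable e cpsi) hM).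
- have [M hM] := C1c_bounded cpsi.
  exact: (integrableM_bounded gi (C1c_measurable cpsi) hM).
Qed.

(** The increment of the test function is the integral of its derivative along the
    segment; by Fubini and the definition of [g], each derivative of a translated
    test function is traded for [g], and the translation is then moved to [g]. *)
Lemma integral_test_translate C U e u g psi : weak_derive C e u g ->
  (forall x t, U x -> 0 <= t <= 1 -> C (x + t *: e)) -> C1c U psi ->
  \int[mu]_x (u x * (psi (x - e) - psi x)) =
  \int[mu]_x (line_average g e x * psi x).
Proof.
move=> [ui gi h] UC cpsi.
have [M hM] := C1c_bounded cpsi.
have [M' hM'] := C1c_derive_bounded (- e) cpsi.
have mpsi := C1c_measurable cpsi.
have mdpsi := C1c_derive_measurable (- e) cpsi.
have cp := C1c_C1 cpsi; have [dp _] := cp.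
have mu_u := integrable_measurable ui.
rewrite -(fubini_line_average e gi mpsi hM).
pose k t x := u x * 'D_(- e) psi (x + t *: (- e)).
have mk : measurable_fun setT (fun p : measurableTypeR R * V => k p.1 p.2).
  apply: measurable_funM; last exact: (measurable_line (- e) mdpsi).
  exact: (measurableT_comp mu_u measurable_snd).
have kM t : 0 <= t <= 1 -> (\int[mu]_x `|(k t x)%:E| <= (M' * \int[mu]_x `|u x|)%:E)%E.
  move=> _; have := @integral_abs_translate _ _ u
    (fun x => 'D_(- e) psi (x + t *: (- e))) 0 M' ui.
  under eq_integral do rewrite addr0; apply => //.
  by apply: (measurableT_comp mdpsi); exact: measurable_translate.
transitivity (\int[mu]_x \int[leb]_(t in `[0, 1]) k t x).
  apply: eq_Rintegral => x _; rewrite /k RintegralZl//.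
    by rewrite FTC_line.
  apply: continuous_compact_integrable; first exact: segment_compact.
  apply: continuous_subspaceT; have [_ cdp] := cp.
  exact: (@continuous_line _ _ _ (- e) x (cdp (- e))).
transitivity (\int[leb]_(t in `[0, 1]) \int[mu]_x k t x).
  by rewrite (@fubini_unit _ _ _ (@sigma_finite_lebesgue R n) k _ mk kM).
apply: eq_Rintegral => t; rewrite inE /= in_itv /= => t01.
have cpsit : C1c C (fun x => psi (x + t *: (- e))).
  by apply: C1c_translate cpsi _ => x Ux; rewrite scalerN opprK; exact: UC.
transitivity (- \int[mu]_x (u x * 'D_e (fun x => psi (x + t *: (- e))) x)).
  rewrite -[RHS]mulN1r -RintegralZl//.
    by apply: eq_Rintegral => x _; rewrite /k derive_translate deriveNd// mulrN mulN1r.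
  have [M1 hM1] := C1c_derive_bounded e cpsit.
  exact: (integrableM_bounded ui (C1c_derive_measurable e cpsit) hM1).
rewrite h// opprK.
rewrite -[LHS](Rintegral_translate (t *: e)).
  by apply: eq_Rintegral => x _; rewrite scalerN addrK.
exact: (integrableM_bounded gi (C1c_measurable cpsit) (fun x => hM _)).
Qed.

(** The pointwise form of the preceding identity, by the fundamental lemma. *)
Theorem translate_weak_derive C U e u g : open U -> weak_derive C e u g ->
  (forall x t, U x -> 0 <= t <= 1 -> C (x + t *: e)) ->
  {ae mu, forall x, U x -> u (x + e) - u x = line_average g e x}.
Proof.
move=> oU wd UC; have [ui gi h] := wd.
have iue := integrable_translate e ui.
have ila := integrable_line_average e gi.
have i1 : mu.-integrable setT (EFin \o (fun x => u (x + e) - u x)).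
  by have := integrableB measurableT iue ui.
have ifd : mu.-integrable setT (EFin \o (fun x => (u (x + e) - u x) - line_average g e x)).
  by have := integrableB measurableT i1 ila.
suff : {ae mu, forall x, U x -> (u (x + e) - u x) - line_average g e x = 0}.
  by apply: filterS => x hx /hx /subr0_eq.
apply: fundamental_lemma => // psi cpsi.
have [M hM] := C1c_bounded cpsi; have mpsi := C1c_measurable cpsi.
have bi f : mu.-integrable setT (EFin \o f) ->
    mu.-integrable setT (EFin \o (fun x => f x * psi x)).
  by move=> fi; exact: (integrableM_bounded fi mpsi hM).
have mpsie : measurable_fun setT (fun x : V => psi (x - e)).
  by apply: (measurableT_comp mpsi); exact: measurable_translate.
have ipsie := integrableM_bounded ui mpsie (fun x => hM _).
under eq_Rintegral do rewrite mulrBl.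
rewrite RintegralB//; [|exact: bi|exact: bi].
rewrite -(integral_test_translate wd UC cpsi).
apply/eqP; rewrite subr_eq0; apply/eqP.
under eq_Rintegral do rewrite mulrBl.
rewrite RintegralB//; [|exact: bi|exact: bi].
under [RHS]eq_Rintegral do rewrite mulrBr.
rewrite RintegralB//; last exact: bi.
congr (_ - _).
rewrite -[RHS](Rintegral_translate e); last exact: ipsie.
by apply: eq_Rintegral => x _; rewrite addrK.
Qed.

End weak_derivatives.

(** * Difference quotients of a C^1 function of one variable *)

Section difference_quotient.
Context {R : realType}.
Variables (Phi dPhi : R -> R) (M : R).
Hypothesis dPhiP : forall s : R, is_derive s 1 Phi (dPhi s).
Hypothesis cdPhi : continuous dPhi.
Hypothesis dPhiM : forall s, `|dPhi s| <= M.

(** The value on the diagonal makes the quotient continuous there; this is what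
    handles the points where the two translates of [u] coincide. *)
Definition diff_quot (a b : R) : R :=
  if a == b then dPhi a else (Phi b - Phi a) / (b - a).

Lemma continuous_primitive : continuous Phi.
Proof.
move=> s; apply: differentiable_continuous; apply/derivable1_diffP.
by have [] := dPhiP s.
Qed.

Lemma diff_quotM a b : diff_quot a b * (b - a) = Phi b - Phi a.
Proof.
rewrite /diff_quot; case: eqP => [->|/eqP ab]; first by rewrite !subrr mulr0.
by rewrite divfK// subr_eq0 eq_sym.
Qed.

Lemma diff_quot_mean a b : exists c, [/\ Num.min a b <= c, c <= Num.max a b &
  diff_quot a b = dPhi c].
Proof.
rewrite /diff_quot; case: eqP => [->|/eqP ab].
  by exists b; rewrite minxx maxxx lexx.
wlog lab : a b ab / a < b.
  move=> wl; have := ab; rewrite neq_lt => /orP[/(wl _ _ ab)//|ba].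
  have [] := wl _ _ _ ba; first by rewrite eq_sym.
  move=> c [c1 c2 c3]; exists c; rewrite minC maxC; split => //.
  by rewrite -c3 -(opprB (Phi a)) -(opprB a) invrN mulrNN.
have [c] := MVT lab (fun x _ => dPhiP x) (continuous_subspaceT continuous_primitive).
rewrite in_itv /= => /andP[ac cb] h; exists c.
rewrite (min_l (ltW lab)) (max_r (ltW lab)) !ltW//; split=> //.
by rewrite h mulfK// subr_eq0 eq_sym.
Qed.

Lemma diff_quot_bound a b : `|diff_quot a b| <= M.
Proof. by have [c [_ _ ->]] := diff_quot_mean a b. Qed.

Lemma diff_quot_cvg (a_ b_ : nat -> R) (c : R) :
  a_ k @[k --> \oo] --> c -> b_ k @[k --> \oo] --> c ->
  diff_quot (a_ k) (b_ k) @[k --> \oo] --> dPhi c.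
Proof.
move=> ac bc; apply/cvgrPdist_le => e e0.
have /cvgrPdist_le/(_ _ e0)/nbhs_ballP[r /= r0 hr] :
  dPhi s @[s --> c] --> dPhi c by exact: cdPhi.
near=> k.
have [z [z1 z2 ->]] := diff_quot_mean (a_ k) (b_ k).
apply: hr; rewrite /ball /= ltr_norml.
have : `|c - a_ k| < r.
  by near: k; move/cvgrPdist_lt : ac; exact.
have : `|c - b_ k| < r.
  by near: k; move/cvgrPdist_lt : bc; exact.
rewrite !ltr_norml => /andP[h1 h2] /andP[h3 h4].
move: z1 z2; case: (leP (a_ k) (b_ k)) => ab z1 z2; apply/andP; split; lra.
Unshelve. all: by end_near. Qed.

Lemma measurable_inv : measurable_fun setT (fun x : R => x^-1).
Proof.
(* powers with exponent -1 are inverses for nonnegative bases only *)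
have -> : (fun x : R => x^-1) = (fun x => x * powR (x ^+ 2) (- 1)).
  apply/funext => x; rewrite powR_inv1 ?sqr_ge0//.
  have [->|x0] := eqVneq x 0; first by rewrite invr0 mul0r.
  by rewrite expr2 invfM mulrA divff// mul1r.
apply: measurable_funM => //; apply: (measurableT_comp (measurable_powR _)).
exact: measurable_funX.
Qed.

Lemma measurable_diff_quot d (T : measurableType d) (u v : T -> R) :
  measurable_fun setT u -> measurable_fun setT v ->
  measurable_fun setT (fun x => diff_quot (u x) (v x)).
Proof.
move=> mu mv; rewrite /diff_quot.
have mPhi := continuous_measurable_fun continuous_primitive.
have mdPhi := continuous_measurable_fun cdPhi.
apply: measurable_fun_ifT.
- exact: measurable_fun_eqr.
- exact: (measurableT_comp mdPhi).
- apply: measurable_funM.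
    by apply: measurable_funB; exact: (measurableT_comp mPhi).
  by apply: (measurableT_comp measurable_inv); exact: measurable_funB.
Qed.

End difference_quotient.

(** * Almost everywhere convergence of translates *)

Section translates_converge.
Context {R : realType} {n : nat}.
Notation V := ('rV[R]_n).
Notation mu := (lebesgue_rV R n).
Implicit Types (u g : V -> R) (e : V) (C U : set V).

(** The sum of the absolute values has a finite integral, so the series converges
    almost everywhere and its terms tend to 0. *)
Lemma ae_cvg0_summable (D : nat -> V -> R) (B : R) :
  (forall k, measurable_fun setT (D k)) ->
  (forall k, (\int[mu]_x `|(D k x)%:E| <= (B / (2 ^ k.+1)%:R)%:E)%E) -> 0 <= B ->
  {ae mu, forall x, D k x @[k --> \oo] --> 0}.
Proof.
move=> mD DB B0.
pose S x := (\sum_(k <oo) `|(D k x)%:E|)%E.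
have mS : measurable_fun setT S.
  apply: (ge0_emeasurable_sum) => [k x _ _|k _]; first exact: abse_ge0.
  by apply: measurableT_comp => //; exact/measurable_EFinP.
have iS : mu.-integrable setT S.
  apply/integrableP; split => //; apply: (@le_lt_trans _ _ B%:E); last exact: ltry.
  under eq_integral => x _ do rewrite gee0_abs ?nneseries_ge0//.
  rewrite integral_nneseries//; last first.
    by move=> k; apply: measurableT_comp => //; exact/measurable_EFinP.
  apply: le_trans (epsilon_trick0 xpredT B0).
  by apply: lee_nneseries => k *; [exact: integral_ge0|exact: DB].
apply: filterS (integrable_ae measurableT iS) => x /(_ I) Sx.
have cS : cvgn (series (fun k => `|D k x|)).
  apply: nondecreasing_is_cvgn.
    by apply/nondecreasing_seqP => k; rewrite /series /= big_nat_recr//= lerDl.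
  exists (fine (S x)) => _ [k _ <-]; rewrite -lee_fin fineK// /series /=.
  rewrite -sumEFin; apply: le_trans (nneseries_lim_ge k _); last by move=> *; exact: abse_ge0.
  exact: lexx.
by apply/norm_cvg0P; exact: cvg_series_cvg_0 cS.
Qed.

(** Translations are continuous in [L^1] only in general. For a function with an
    integrable derivative, however, the [L^1] norm of [u(. + s e) - u] is at most
    [|s|] times that of [g]: it is summable along geometric steps, which gives
    convergence almost everywhere. *)
Lemma ae_cvg_translate C U e u g (r : R) (s_ : nat -> R) : open U ->
  weak_derive C e u g -> 0 <= r ->
  (forall x s, U x -> `|s| <= r -> C (x + s *: e)) ->
  (forall k, `|s_ k| <= r / (2 ^ k.+1)%:R) ->
  {ae mu, forall x, U x -> u (x + s_ k *: e) @[k --> \oo] --> u x}.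
Proof.
move=> oU wd r0 UC sr; have [ui gi _] := wd.
pose D k := line_average (fun x => s_ k * g x) (s_ k *: e).
have gsi k : mu.-integrable setT (EFin \o (fun x => s_ k * g x)).
  by have [] := weak_deriveZ (s_ k) wd.
have sr' k : `|s_ k| <= r.
  apply: (le_trans (sr k)); rewrite ler_pdivrMr ?ltr0n ?expn_gt0//.
  by rewrite ler_peMr// ler1n expn_gt0.
have h1 : {ae mu, forall x k, U x -> u (x + s_ k *: e) - u x = D k x}.
  apply: ae_foralln => k.
  apply: (translate_weak_derive oU (weak_deriveZ (s_ k) wd)) => x t Ux /andP[t0 t1].
  rewrite scalerA; apply: UC => //; rewrite normrM ger0_norm//.
  by apply: le_trans (sr' k); rewrite ler_piMl.
have h2 : {ae mu, forall x, D k x @[k --> \oo] --> 0}.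
  apply: (@ae_cvg0_summable _ (r * \int[mu]_x `|g x|)).
  - by move=> k; apply: integrable_measurable; exact: integrable_line_average.
  - move=> k; apply: (le_trans (le_integral_line_average _ (gsi k))).
    rewrite lee_fin; under eq_Rintegral do rewrite normrM.
    rewrite RintegralZl//; last exact: (integrable_abse gi).
    rewrite mulrAC ler_wpM2r//.
    by apply: Rintegral_ge0.
  - by rewrite mulr_ge0//; apply: Rintegral_ge0.
apply: filterS2 h1 h2 => x h1 h2 Ux.
rewrite (_ : (fun k => _) = (fun k => u x + D k x)).
  by rewrite -[X in _ --> X]addr0; apply: cvgD h2; exact: cvg_cst.
by apply/funext => k; rewrite -h1// [RHS]addrC subrK.
Qed.

End translates_converge.

(** * The chain rule for weak derivatives *)

Section chain_rule.
Context {R : realType} {n : nat}.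
Notation V := ('rV[R]_n).
Notation mu := (lebesgue_rV R n).
Notation leb := (@lebesgue_measure R).
Implicit Types (u g phi H : V -> R) (e : V) (C U K : set V).

Lemma integrable_indic_compact K : compact K ->
  mu.-integrable setT (EFin \o (\1_K : V -> R)).
Proof.
move=> cK; have mK := compact_measurable_rV cK.
apply/integrableP; split.
  by apply/measurable_EFinP; exact: measurable_indic.
under eq_integral => x _ do rewrite /= ger0_norm//.
rewrite integral_indic// setIT; apply: lebesgue_bounded_lty => //.
exact: compact_bounded.
Qed.

Lemma integrable_compact_support K (f : V -> R) (M : R) : compact K ->
  measurable_fun setT f -> (forall x, `|f x| <= M) ->
  (forall x, ~ K x -> f x = 0) -> mu.-integrable setT (EFin \o f).
Proof.
move=> cK mf fM f0.
have := integrableM_bounded (integrable_indic_compact cK) mf fM.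
congr (integrable _ _ _); apply/funext => x /=; rewrite indicE.
case: (boolP (x \in K)); rewrite ?mul1r// notin_setE => /f0 ->.
by rewrite mulr0.
Qed.

Lemma integrable_test U phi : C1c U phi -> mu.-integrable setT (EFin \o phi).
Proof.
move=> cphi; have [M hM] := C1c_bounded cphi.
have [_ _ [K [cK _ p0]]] := cphi.
exact: integrable_compact_support cK (C1c_measurable cphi) hM p0.
Qed.

Lemma integrable_derive_test U phi e : C1c U phi ->
  mu.-integrable setT (EFin \o 'D_e phi).
Proof.
move=> cphi; have [M hM] := C1c_derive_bounded e cphi.
have [_ _ [K [cK _ p0]]] := cphi.
apply: (integrable_compact_support cK (C1c_derive_measurable e cphi) hM).
exact: derive_support.
Qed.

Lemma test_increment_bound U phi e (M h : R) x : C1c U phi ->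
  (forall x, `|'D_e phi x| <= M) -> `|phi (x + h *: e) - phi x| <= M * `|h|.
Proof.
move=> cphi hM; have [dp cp] := C1c_C1 cphi.
have cphi0 := C1_continuous (C1c_C1 cphi).
wlog h0 : h x / 0 <= h.
  move=> wl; have [|h0] := leP 0 h; first exact: wl.
  have := wl (- h) (x + h *: e); rewrite scaleNr addrK normrN distrC; apply.
  by rewrite oppr_ge0 ltW.
have [c _ hc] := MVT_segment h0
  (fun t _ => is_derive_line (dp (x + t *: e)))
  (continuous_subspaceT (@continuous_line _ _ _ e x cphi0)).
move: hc; rewrite scale0r addr0 subr0 => ->.
by rewrite normrM ler_wpM2r.
Qed.

Lemma test_increment_cvg U phi e (h_ : nat -> R) x : C1c U phi ->
  h_ k @[k --> \oo] --> (0 : R) -> (forall k, h_ k != 0) ->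
  (phi (x + h_ k *: e) - phi x) / h_ k @[k --> \oo] --> 'D_e phi x.
Proof.
move=> cphi hc h0; have [dp cp] := C1c_C1 cphi.
have /cvg_ex[l hl] := @diff_derivable _ _ _ _ _ e (dp x).
have -> : 'D_e phi x = l by exact: cvg_lim hl.
have /cvgr_dnbhsP/(_ h_) := hl.
rewrite (_ : (fun k => _ / _) = (fun k => (h_ k)^-1 *: (phi (h_ k *: e + x) - phi x))).
  by apply; split.
by apply/funext => k; rewrite [x + _]addrC mulrC.
Qed.

Variables (Phi dPhi : R -> R) (M B : R).
Hypothesis dPhiP : forall s : R, is_derive s 1 Phi (dPhi s).
Hypothesis cdPhi : continuous dPhi.
Hypothesis dPhiM : forall s, `|dPhi s| <= M.
Hypothesis PhiB : forall s, `|Phi s| <= B.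

Let cPhi : continuous Phi. Proof. exact: continuous_primitive dPhiP. Qed.
Let mPhi : measurable_fun setT Phi. Proof. exact: continuous_measurable_fun. Qed.
Let mdPhi : measurable_fun setT dPhi. Proof. exact: continuous_measurable_fun. Qed.

Lemma norm_Rintegral_le g H (M1 : R) : mu.-integrable setT (EFin \o g) ->
  measurable_fun setT H -> (forall x, `|H x| <= M1) ->
  `|\int[mu]_x (g x * H x)| <= M1 * \int[mu]_x `|g x|.
Proof.
move=> gi mH HM; have igH := integrableM_bounded gi mH HM.
apply: (le_trans (le_normr_Rintegral _ igH)) => //.
rewrite -RintegralZl//; last exact: (integrable_abse gi).
apply: le_Rintegral => //; first exact: (integrable_abse igH).
  by have := integrableZl measurableT M1 (integrable_abse gi).
by move=> x _; rewrite normrM mulrC ler_wpM2r.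
Qed.

Lemma measurable_fubini_line g H e (M1 : R) : mu.-integrable setT (EFin \o g) ->
  measurable_fun setT H -> (forall x, `|H x| <= M1) ->
  measurable_fun (`[0, 1]%classic : set (measurableTypeR R))
    (fun t => \int[mu]_x (g (x + t *: e) * H x)).
Proof.
move=> gi mH HM; have mg := integrable_measurable gi.
have mk : measurable_fun setT
    (fun p : measurableTypeR R * V => g (p.2 + p.1 *: e) * H p.2).
  apply: measurable_funM; first exact: measurable_line.
  exact: (measurableT_comp mH measurable_snd).
exact: (@measurable_unit_l _ _ _ (@sigma_finite_lebesgue R n)
  (fun t x => g (x + t *: e) * H x) _ mk
  (fun t _ => integral_abs_translate (t *: e) gi mH HM)).
Qed.

(** The pairing of [g(. + t h e)] with the difference quotient of [Phi] between [u]
    and [u(. + h e)] times the test function, after the substitution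
    [x -> x - t h e], which leaves [g] untranslated. *)
Let shifted_pairing u g phi e (h : R) (t : R) : R := \int[mu]_x
  (g x * (diff_quot Phi dPhi (u (x - (t * h) *: e)) (u (x + ((1 - t) * h) *: e)) *
     phi (x - (t * h) *: e))).

(** The discrete chain rule. The translation of the test function is moved to
    [Phi(u)], whose increment is the difference quotient times the increment of [u],
    that is, [h] times an average of [g] along the segment. *)
Lemma difference_identity C U e u g phi (h : R) : open U ->
  weak_derive C e u g ->
  (forall x t, U x -> 0 <= t <= 1 -> C (x + t *: (h *: e))) ->
  C1c U phi ->
  \int[mu]_x (Phi (u x) * (phi (x - h *: e) - phi x)) =
  h * \int[leb]_(t in `[0, 1]) shifted_pairing u g phi e h t /\
  measurable_fun (`[0, 1]%classic : set (measurableTypeR R))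
    (shifted_pairing u g phi e h).
Proof.
move=> oU wd UC cphi; have [ui gi _] := wd.
have mu_u := integrable_measurable ui.
have mphi := C1c_measurable cphi; have iphi := integrable_test cphi.
have [M1 hM1] := C1c_bounded cphi.
have mPhiu : measurable_fun setT (Phi \o u) by exact: (measurableT_comp mPhi).
have mue : measurable_fun setT (fun x : V => u (x + h *: e)).
  by apply: (measurableT_comp mu_u); exact: measurable_translate.
have mPhiue : measurable_fun setT (fun x : V => Phi (u (x + h *: e))).
  exact: (measurableT_comp mPhi).
have iPhi := integrableM_bounded iphi mPhiu (fun x => PhiB _).
have iPhie := integrableM_bounded iphi mPhiue (fun x => PhiB _).
have iPhit := integrableM_bounded (integrable_translate (- (h *: e)) iphi)
  mPhiu (fun x => PhiB _).
pose H x := diff_quot Phi dPhi (u x) (u (x + h *: e)) * phi x.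
have mH : measurable_fun setT H.
  by apply: measurable_funM => //; exact: (measurable_diff_quot dPhiP cdPhi).
have HM x : `|H x| <= M * M1.
  by rewrite normrM ler_pM// (diff_quot_bound dPhiP dPhiM).
(* undo the substitution: [x - t h e + h e = x + (1 - t) h e] *)
have BE t : shifted_pairing u g phi e h t = \int[mu]_x (g (x + t *: (h *: e)) * H x).
  have mHt : measurable_fun setT (fun x : V => H (x - t *: (h *: e))).
    by apply: (measurableT_comp mH); exact: measurable_translate.
  have := Rintegral_translate (t *: (h *: e))
    (integrableM_bounded gi mHt (fun x => HM _)).
  under eq_Rintegral do rewrite addrK.
  move=> ->; apply: eq_Rintegral => x _; rewrite /H scalerA.
  have -> : x - (t * h) *: e + h *: e = x + ((1 - t) * h) *: e.
    by rewrite -addrA mulrBl mul1r scalerBl [- _ + _]addrC.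
  by [].
have BM t : `|shifted_pairing u g phi e h t| <= (M * M1) * \int[mu]_x `|g x|.
  rewrite BE -(Rintegral_translate (t *: (h *: e)) (integrable_abse gi)).
  exact: norm_Rintegral_le (integrable_translate _ gi) mH HM.
have mB : measurable_fun (`[0, 1]%classic : set (measurableTypeR R))
    (shifted_pairing u g phi e h).
  rewrite (funext BE); exact: (measurable_fubini_line (h *: e) gi mH HM).
split => //.
transitivity (\int[mu]_x (line_average (fun x => h * g x) (h *: e) x * H x)).
  under eq_Rintegral do rewrite mulrC mulrBl.
  rewrite RintegralB//.
  rewrite -[X in X - _](Rintegral_translate (h *: e))//.
  under [X in X - _]eq_Rintegral do rewrite addrK.
  rewrite -RintegralB//.
  have wdh := weak_deriveZ h wd; have [_ gih _] := wdh.
  apply: Rintegral_ae_eq => //.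
  - by apply: measurable_funB; apply: measurable_funM.
  - apply: measurable_funM => //; apply: integrable_measurable.
    exact: integrable_line_average.
  - apply: filterS (translate_weak_derive oU wdh UC) => x hx _.
    have [Ux|nUx] := pselect (U x).
      rewrite -hx// /H mulrA [_ * diff_quot _ _ _ _]mulrC diff_quotM//.
      by rewrite mulrBl ![_ * phi x]mulrC.
    have phi0 : phi x = 0.
      by have [_ _ [K [_ KU p0]]] := cphi; apply: p0 => /KU.
    by rewrite /H phi0 !mul0r !mulr0 subr0.
have [_ gih _] := weak_deriveZ h wd.
rewrite -(fubini_line_average (h *: e) gih mH HM).
rewrite -RintegralZl//; last first.
  apply: (@integrable_bounded _ _ _ leb _ _ _ (measurable_itv `[0, 1]) _ mB
    (fun t _ => BM t)).
  by rewrite [X in (X < _)%E](lebesgue_measure_itv `[0, 1]) /= lte_fin ltr01 -EFinB ltry.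
apply: eq_Rintegral => t _; rewrite BE.
rewrite -RintegralZl//; last first.
  exact: (integrableM_bounded (integrable_translate (t *: (h *: e)) gi) mH HM).
by apply: eq_Rintegral => x _; rewrite mulrA.
Qed.

Let halves (r : R) (k : nat) : R := r / (2 ^ k.+1)%:R.

Let halves_gt0 r k : 0 < r -> 0 < halves r k.
Proof. by move=> r0; rewrite divr_gt0// ltr0n expn_gt0. Qed.

Let halves_le r k : 0 < r -> halves r k <= r.
Proof.
move=> r0; rewrite ler_pdivrMr ?ltr0n ?expn_gt0// ler_peMr ?(ltW r0)//.
by rewrite ler1n expn_gt0.
Qed.

Let halves_cvg r : halves r k @[k --> \oo] --> (0 : R).
Proof.
have h : geometric (r / 2) (2^-1) k @[k --> \oo] --> (0 : R).
  by apply: cvg_geometric; rewrite ger0_norm// invf_lt1// ltr1n.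
rewrite (_ : halves r = geometric (r / 2) 2^-1)//; apply/funext => k.
by rewrite /halves /geometric /= expnS natrM natrX invfM exprVn mulrA.
Qed.

(** Dominated convergence: the increments are bounded by the supremum of the
    derivative and live on a fixed compact neighbourhood of the support. *)
Lemma test_increment_integral_cvg U u e phi (h_ : nat -> R) (r : R) : C1c U phi ->
  measurable_fun setT u -> 0 <= r ->
  h_ k @[k --> \oo] --> (0 : R) -> (forall k, h_ k != 0) ->
  (forall k, `|h_ k| <= r) ->
  \int[mu]_x (Phi (u x) * ((phi (x + h_ k *: e) - phi x) / h_ k)) @[k --> \oo] -->
  \int[mu]_x (Phi (u x) * 'D_e phi x).
Proof.
move=> cphi mu_u r0 hc h0 hr.
have mphi := C1c_measurable cphi.
have mPhiu : measurable_fun setT (fun x => Phi (u x)) by exact: (measurableT_comp mPhi).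
have [M2 hM2] := C1c_derive_bounded e cphi.
have [_ _ [K [cK KU p0]]] := cphi.
pose K' := thicken K (r * `|e|).
have cK' : compact K' by exact: compact_thicken.
have iK' : mu.-integrable setT (EFin \o (fun x : V => (B * M2) * \1_K' x)).
  by have := integrableZl measurableT (B * M2) (integrable_indic_compact cK').
apply: (@dominated_Rintegral _ _ _ _ _
  (fun k x => Phi (u x) * ((phi (x + h_ k *: e) - phi x) / h_ k)) _ _ _ _ _ _ iK') => //.
- move=> k; apply: measurable_funM => //; apply: measurable_funM => //.
  apply: measurable_funB => //; apply: (measurableT_comp mphi).
  exact: measurable_translate.
- by apply: measurable_funM => //; exact: C1c_derive_measurable cphi.
- by apply: aeW => x _; apply: cvgMl_tmp; exact: test_increment_cvg cphi hc h0.
- move=> k x _; rewrite normrM -mulrA; apply: ler_pM => //.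
  rewrite normrM normfV ler_pdivrMr ?normr_gt0//.
  rewrite indicE; case: (boolP (x \in K')) => xK'.
    by rewrite mulr1; exact: test_increment_bound cphi hM2.
  move: xK'; rewrite notin_setE => xK'.
  rewrite mulr0 mul0r !p0 ?subrr ?normr0// => Kx; apply: xK'.
    by apply: thicken_self => //; rewrite mulr_ge0.
  exists (x + h_ k *: e) => //.
  by rewrite opprD addNKr normrN normrZ ler_wpM2r.
Qed.

(** Let [h = r 2^{-k-1}] tend to 0 in the discrete chain rule. On the right, for each
    [t], both arguments of the difference quotient converge to [u(x)] for almost
    every [x], so dominated convergence applies in [x] and then in [t]. *)
Theorem chain_rule_weak_derive C U e u g phi (r : R) : open U ->
  weak_derive C e u g -> 0 < r ->
  (forall x s, U x -> `|s| <= r -> C (x + s *: e)) -> C1c U phi ->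
  \int[mu]_x (Phi (u x) * 'D_e phi x) = - \int[mu]_x (dPhi (u x) * g x * phi x).
Proof.
move=> oU wd r0 UC cphi; have [ui gi _] := wd.
have mu_u := integrable_measurable ui.
have mphi := C1c_measurable cphi.
have [M1 hM1] := C1c_bounded cphi.
pose h_ := halves r.
have lhs : \int[mu]_x (Phi (u x) * ((phi (x + (- h_ k) *: e) - phi x) / (- h_ k)))
    @[k --> \oo] --> \int[mu]_x (Phi (u x) * 'D_e phi x).
  apply: (@test_increment_integral_cvg U u e phi (fun k => - h_ k) r) => //.
  - exact: ltW.
  - by rewrite -[X in _ --> X]oppr0; apply: cvgN; exact: halves_cvg.
  - by move=> k; rewrite oppr_eq0 gt_eqF// halves_gt0.
  - by move=> k; rewrite normrN ger0_norm ?halves_le// ltW// halves_gt0.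
pose L := \int[mu]_x (g x * (dPhi (u x) * phi x)).
have DI k := @difference_identity C U e u g phi (h_ k) oU wd.
have UC' k x t : U x -> 0 <= t <= 1 -> C (x + t *: (h_ k *: e)).
  move=> Ux /andP[t0 t1]; rewrite scalerA; apply: UC => //.
  have hk0 : 0 <= h_ k by rewrite ltW// halves_gt0.
  by rewrite ger0_norm ?mulr_ge0// (le_trans _ (halves_le k r0))// ler_piMl.
have HM k t x : `|diff_quot Phi dPhi (u (x - (t * h_ k) *: e))
     (u (x + ((1 - t) * h_ k) *: e)) * phi (x - (t * h_ k) *: e)| <= M * M1.
  by rewrite normrM ler_pM// (diff_quot_bound dPhiP dPhiM).
have mH k t : measurable_fun setT (fun x : V => diff_quot Phi dPhi (u (x - (t * h_ k) *: e))
     (u (x + ((1 - t) * h_ k) *: e)) * phi (x - (t * h_ k) *: e)).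
  apply: measurable_funM.
    apply: (measurable_diff_quot dPhiP cdPhi); apply: (measurableT_comp mu_u);
      exact: measurable_translate.
  by apply: (measurableT_comp mphi); exact: measurable_translate.
have BL t : 0 <= t <= 1 -> shifted_pairing u g phi e (h_ k) t @[k --> \oo] --> L.
  move=> /andP[t0 t1].
  have iG : mu.-integrable setT (EFin \o (fun x => (M * M1) * `|g x|)).
    by have := integrableZl measurableT (M * M1) (integrable_abse gi).
  apply: (@dominated_Rintegral _ _ _ _ _ (fun k x => g x *
    (diff_quot Phi dPhi (u (x - (t * h_ k) *: e)) (u (x + ((1 - t) * h_ k) *: e)) *
     phi (x - (t * h_ k) *: e))) _ _ _ _ _ _ iG) => //.
  - by move=> k; apply: measurable_funM => //; exact: integrable_measurable.
  - apply: measurable_funM; first exact: integrable_measurable.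
    by apply: measurable_funM => //; exact: (measurableT_comp mdPhi).
  - have sr s : `|s| <= 1 -> forall k, `|s * h_ k| <= r / (2 ^ k.+1)%:R.
      move=> s1 k; have hk0 : 0 <= h_ k by rewrite ltW// halves_gt0.
      by rewrite normrM [`|h_ k|]ger0_norm// ler_piMl.
    have t1' : `|- t| <= 1 by rewrite normrN ger0_norm.
    have t1'' : `|1 - t| <= 1 by rewrite ger0_norm ?subr_ge0// lerBlDr lerDl.
    (* the two translates have steps [- t h] and [(1 - t) h], both at most [h] in size *)
    have c1 := @ae_cvg_translate _ _ C U e u g r (fun k => - t * h_ k)
      oU wd (ltW r0) UC (sr _ t1').
    have c2 := @ae_cvg_translate _ _ C U e u g r (fun k => (1 - t) * h_ k)
      oU wd (ltW r0) UC (sr _ t1'').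
    apply: filterS2 c1 c2 => x h1 h2 _.
    have pc : phi (x - (t * h_ k) *: e) @[k --> \oo] --> phi x.
      have sc : t * h_ k @[k --> \oo] --> (0 : R).
        by rewrite -[X in _ --> X](mulr0 t); apply: cvgMl_tmp; exact: halves_cvg.
      have := cvg_comp _ _ sc
        (@continuous_line _ _ phi (- e) x (C1_continuous (C1c_C1 cphi)) 0).
      rewrite scale0r addr0; apply: cvg_trans.
      by apply: near_eq_cvg; apply: nearW => k /=; rewrite scalerN.
    have [Ux|nUx] := pselect (U x).
      apply: cvgMl_tmp; apply: cvgM => //.
      apply: (diff_quot_cvg dPhiP cdPhi); last exact: h2.
      by under eq_fun do rewrite -scaleNr -mulNr; exact: h1.
    have phi0 : phi x = 0.
      by have [_ _ [K [_ KU p0]]] := cphi; apply: p0 => /KU.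
    (* outside [U] the translates of [u] need not converge, but the quotient is bounded
       and the test function tends to 0 *)
    rewrite phi0 !mulr0 -[X in _ --> X](mulr0 (g x)); apply: cvgMl_tmp.
    have M0 : 0 <= M by exact: le_trans (dPhiM 0).
    apply/cvgr0Pnorm_le => eps eps0.
    have : \forall k \near \oo, `|phi (x - (t * h_ k) *: e)| <= eps / (M + 1).
      have /cvgr0Pnorm_le : phi (x - (t * h_ k) *: e) @[k --> \oo] --> (0 : R).
        by rewrite -phi0.
      by apply; rewrite divr_gt0// ltr_wpDl.
    apply: filterS => k hk; rewrite normrM.
    apply: (@le_trans _ _ ((M + 1) * (eps / (M + 1)))).
      apply: ler_pM => //; apply: le_trans (diff_quot_bound dPhiP dPhiM _ _) _.
      by rewrite lerDl.
    by rewrite mulrC divfK// gt_eqF// ltr_wpDl.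
  - move=> k x _; rewrite normrM mulrC ler_wpM2r//; exact: HM.
have mB k : measurable_fun (`[0, 1]%classic : set (measurableTypeR R))
    (shifted_pairing u g phi e (h_ k)).
  by have [] := DI k (UC' k) cphi.
have BM k t : `|shifted_pairing u g phi e (h_ k) t| <= M * M1 * \int[mu]_x `|g x|.
  exact: norm_Rintegral_le gi (mH k t) (HM k t).
have rhs : \int[leb]_(t in `[0, 1]) shifted_pairing u g phi e (h_ k) t @[k --> \oo] --> L.
  have -> : L = \int[leb]_(t in `[0, 1]) cst L t.
    rewrite Rintegral_cst// [X in fine X](lebesgue_measure_itv `[0, 1]) /=.
    by rewrite lte_fin ltr01 -EFinB subr0 mulr1.
  have i1 : leb.-integrable `[0, 1] (EFin \o cst (M * M1 * \int[mu]_x `|g x|)).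
    apply: continuous_compact_integrable; first exact: segment_compact.
    by apply: continuous_subspaceT; exact: cst_continuous.
  apply: (@dominated_Rintegral _ _ _ leb _ (fun k t => shifted_pairing u g phi e (h_ k) t)
    _ _ _ _ _ _ i1) => //.
  - by apply: aeW => t /=; rewrite in_itv /=; exact: BL.
have E k : \int[mu]_x (Phi (u x) * ((phi (x + (- h_ k) *: e) - phi x) / (- h_ k))) =
    - \int[leb]_(t in `[0, 1]) shifted_pairing u g phi e (h_ k) t.
  have hk0 : h_ k != 0 by rewrite gt_eqF// halves_gt0.
  have iphi := integrable_test cphi.
  have mPhiu : measurable_fun setT (fun x => Phi (u x)) by exact: (measurableT_comp mPhi).
  have [DIk _] := DI k (UC' k) cphi.
  have idphi : mu.-integrable setT (EFin \o (fun x => phi (x - h_ k *: e) - phi x)).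
    by have := integrableB measurableT (integrable_translate (- (h_ k *: e)) iphi) iphi.
  have iP := integrableM_bounded idphi mPhiu (fun x => PhiB _).
  transitivity ((- h_ k)^-1 * \int[mu]_x (Phi (u x) * (phi (x - h_ k *: e) - phi x))).
    rewrite -RintegralZl//.
      by apply: eq_Rintegral => x _; rewrite scaleNr mulrA mulrC.
    by move: iP; congr (integrable _ _ _); apply/funext => x /=; rewrite mulrC.
  by rewrite DIk mulrA invrN mulNr mulVf// mulN1r.
have rhs' : \int[mu]_x (Phi (u x) * ((phi (x + (- h_ k) *: e) - phi x) / (- h_ k)))
    @[k --> \oo] --> - L.
  by rewrite (funext E); exact: cvgN.
transitivity (- L); first exact: cvg_unique lhs rhs'.
congr (- _).
by apply: eq_Rintegral => x _; rewrite mulrA [g x * _]mulrC.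
Qed.

End chain_rule.

(** * Functions invariant under small translations *)

Section locally_constant.
Context {R : realType} {n : nat}.
Notation V := ('rV[R]_n).
Notation mu := (lebesgue_rV R n).
Implicit Types (u : V -> R) (U W : set V) (P : V -> Prop).

Lemma ae_witness U P : measurable U -> (0 < mu U)%E ->
  {ae mu, forall x, U x -> P x} -> exists2 x, U x & P x.
Proof.
move=> mU U0 [N [mN N0 hN]]; apply: contrapT => nex.
have UN : U `<=` N.
  by move=> x Ux; apply: hN => /(_ Ux) Px; apply: nex; exists x.
have : (mu U <= mu N)%E by apply: le_measure; rewrite ?inE.
by rewrite N0 leNgt U0.
Qed.

(** Tonelli: the double integral vanishes in one order, hence in the other. *)
Lemma ae_swap (F : V * V -> \bar R) :
  measurable_fun setT F -> (forall p, 0 <= F p)%E ->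
  (forall e, {ae mu, forall x, F (x, e) = 0%E}) ->
  {ae mu, forall x, {ae mu, forall e, F (x, e) = 0%E}}.
Proof.
move=> mF F0 hF.
pose m := @sigma_finite_lebesgue R n.
have mF1 x : measurable_fun setT (fun e => F (x, e)).
  exact: (measurableT_comp mF (measurable_pair1 x)).
have mF2 e : measurable_fun setT (fun x => F (x, e)).
  exact: (measurableT_comp mF (measurable_pair2 e)).
have I0 : (\int[m]_x \int[m]_e F (x, e) = 0)%E.
  rewrite (fubini_tonelli _ mF F0) integral0_eq// => e _.
  rewrite (ae_eq_integral (cst 0%E)) ?integral0//.
  by apply: filterS (hF e) => x hx _.
have mI : measurable_fun setT (fun x => \int[m]_e F (x, e))%E.
  exact: (measurable_fun_fubini_tonelli_F F mF F0).
have : (\int[m]_x `|\int[m]_e F (x, e)| = 0)%E.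
  by under eq_integral => x _ do rewrite gee0_abs ?integral_ge0//.
move=> /(ae_eq_integral_abs _ measurableT mI); apply: filterS => x /(_ I) hx.
have : (\int[m]_e `|F (x, e)| = 0)%E.
  by under eq_integral => e _ do rewrite gee0_abs//.
by move=> /(ae_eq_integral_abs _ measurableT (mF1 x)); apply: filterS => e; exact.
Qed.

(** The exceptional null set depends on [e]; exchanging the quantifiers gives a point
    [x] with [u(x + e) = u(x)] for almost every [e] of norm less than [2 r], and
    [x + e] then covers the whole ball of radius [r]. *)
Lemma ae_const_translation_invariant u (x0 : V) (r : R) : 0 < r ->
  measurable_fun setT u ->
  (forall e, `|e| < 2 * r -> {ae mu, forall x, ball x0 r x -> u (x + e) = u x}) ->
  exists c, {ae mu, forall x, ball x0 r x -> u x = c}.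
Proof.
move=> r0 mu_u inv.
have oB z s : open (ball (z : V) s) by exact: ball_open.
have mB : measurable (ball x0 r) by exact: open_measurable_rV.
have mB' : measurable (ball (0 : V) (2 * r)) by exact: open_measurable_rV.
pose F (p : V * V) := (`|u (p.1 + p.2) - u p.1| *
   (\1_(ball x0 r) p.1 * \1_(ball (0 : V) (2 * r)) p.2))%:E.
have mF : measurable_fun setT F.
  apply/measurable_EFinP; apply: measurable_funM.
    apply: measurableT_comp => //; apply: measurable_funB.
      apply: (measurableT_comp mu_u); apply: measurable_addr_rV.
        exact: measurable_fst.
      exact: measurable_snd.
    exact: (measurableT_comp mu_u measurable_fst).
  apply: measurable_funM.
    exact: (measurableT_comp (measurable_indic mB) measurable_fst).
  exact: (measurableT_comp (measurable_indic mB') measurable_snd).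
have F0 p : (0 <= F p)%E by rewrite lee_fin !mulr_ge0.
have hF e : {ae mu, forall x, F (x, e) = 0%E}.
  rewrite /F /=; have [eB|eB] := pselect (ball (0 : V) (2 * r) e).
    have : `|e| < 2 * r by move: eB; rewrite -ball_normE /= sub0r normrN.
    move=> /inv; apply: filterS => x hx.
    have [xB|xB] := pselect (ball x0 r x).
      by rewrite hx// subrr normr0 mul0r.
    by rewrite [X in _ * (X * _)]indicE memNset// mul0r mulr0.
  by apply: aeW => x; rewrite [X in _ * (_ * X)]indicE memNset// !mulr0.
have hx := ae_swap mF F0 hF.
have [x xB hxe] : exists2 x, ball x0 r x & {ae mu, forall e, F (x, e) = 0%E}.
  apply: (ae_witness mB).
    by apply: (lebesgue_nbhs_gt0 mB); exact: nbhsx_ballx.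
  by apply: filterS hx => x hx _.
exists (u x).
have := ae_translate (- x) hxe; apply: filterS => y hy yB; move: hy.
rewrite /F /= [x + _]addrC subrK !indicE !mem_set ?mulr1//.
  by move=> [] /eqP; rewrite normr_eq0 subr_eq0 => /eqP.
rewrite -ball_normE /= sub0r normrN mulrDl mul1r.
move: xB yB; rewrite -ball_normE /= => xB yB.
rewrite -(subrK x0 y) -addrA; apply: (le_lt_trans (ler_normD _ _)).
by rewrite ltrD// distrC.
Qed.

End locally_constant.

(** * From weak gradients on a domain to weak derivatives on the whole space *)

Section domains.
Context {R : realType} {n : nat}.
Notation V := ('rV[R]_n).
Notation mu := (lebesgue_rV R n).
Implicit Types (u w : V -> R) (U W K Omega : set V) (e : V) (G : V -> V).

Lemma Rintegral_sum I (s : seq I) (F : I -> V -> R) :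
  (forall i, mu.-integrable setT (EFin \o F i)) ->
  \int[mu]_x (\sum_(i <- s) F i x) = \sum_(i <- s) \int[mu]_x F i x.
Proof.
move=> iF; have iS t : mu.-integrable setT (EFin \o (fun x => \sum_(i <- t) F i x)).
  have := integrable_sum measurableT t (P := xpredT) (fun i _ => iF i).
  by congr (integrable _ _ _); apply/funext => x /=; rewrite sumEFin.
elim: s => [|i s IH].
  by under eq_Rintegral do rewrite big_nil; rewrite big_nil Rintegral0.
under eq_Rintegral do rewrite big_cons.
by rewrite RintegralD// ?big_cons ?IH//; exact: iS.
Qed.

Lemma Rintegral_restrict_test Omega K u psi e : K `<=` Omega -> C1c K psi ->
  \int[mu]_x ((u \_ K) x * 'D_e psi x) = \int[mu]_(x in Omega) (u x * 'D_e psi x) /\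
  \int[mu]_x ((u \_ K) x * psi x) = \int[mu]_(x in Omega) (u x * psi x).
Proof.
move=> KO [_ _ [K' [cK' K'K p0]]].
rewrite [in X in _ = X /\ _]Rintegral_mkcond [in X in _ /\ _ = X]Rintegral_mkcond.
split; apply: eq_Rintegral => x _; rewrite !patchE.
  have [Kx|nKx] := pselect (K x); first by rewrite !mem_set//; exact: KO.
  rewrite memNset// mul0r; case: ifPn => // _.
  by rewrite (derive_support e cK' p0) ?mulr0// => /K'K.
have [Kx|nKx] := pselect (K x); first by rewrite !mem_set//; exact: KO.
rewrite memNset// mul0r; case: ifPn => // _.
by rewrite p0 ?mulr0// => /K'K.
Qed.

Lemma L1_restrict K u : measurable K -> L1 K u -> mu.-integrable setT (EFin \o (u \_ K)).
Proof.
by move=> mK; rewrite /L1 -restrict_EFin => /(integrable_mkcond _ mK).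
Qed.

Lemma weak_grad_local Omega K w G i : compact K -> K `<=` Omega ->
  weak_grad Omega w G ->
  weak_derive K (delta_mx ord0 i) (w \_ K) (Defs.coord G i \_ K).
Proof.
move=> cK KO [[_ wL] GL h]; have mK := compact_measurable_rV cK.
split; [by apply: L1_restrict => //; exact: wL| |].
  by apply: L1_restrict => //; have [_ hL] := GL i; exact: hL.
move=> psi cpsi.
have [-> _] := Rintegral_restrict_test w (delta_mx ord0 i) KO cpsi.
have [_ ->] := Rintegral_restrict_test (Defs.coord G i) (delta_mx ord0 i) KO cpsi.
rewrite -h; last exact: C1c_sub cpsi.
by apply: eq_Rintegral => x _; rewrite /Defs.coord /grad mxE.
Qed.

Lemma weak_derive0_all K u : mu.-integrable setT (EFin \o u) ->
  (forall i, weak_derive K (delta_mx ord0 i) u (cst 0)) ->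
  forall e, weak_derive K e u (cst 0).
Proof.
move=> ui h e; split => //; first exact: integrable0.
move=> psi cpsi; have [dpsi _ _] := cpsi.
have -> : \int[mu]_x (cst 0 x * psi x) = 0.
  by under eq_Rintegral do rewrite mul0r; rewrite Rintegral0.
rewrite oppr0.
under eq_Rintegral do rewrite derive_grad// /dotv mulr_sumr.
rewrite Rintegral_sum.
  apply: big1 => i _; rewrite /grad.
  under eq_Rintegral do rewrite mxE mulrA.
  have [_ _ hi] := h i.
  rewrite RintegralZr//.
    rewrite hi//; under eq_Rintegral do rewrite mul0r.
    by rewrite Rintegral0 oppr0 mul0r.
  have [M hM] := C1c_derive_bounded (delta_mx ord0 i) cpsi.
  exact: integrableM_bounded ui (C1c_derive_measurable _ cpsi) hM.
move=> i.
have [M hM] := C1c_derive_bounded (delta_mx ord0 i) cpsi.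
have := integrableM_bounded ui (C1c_derive_measurable _ cpsi) hM.
move=> /(integrableZr measurableT (e ord0 i)).
by congr (integrable _ _ _); apply/funext => x /=; rewrite /grad mxE mulrA.
Qed.

End domains.

(** * Constancy and the chain rule on a domain *)

Section weak_gradients.
Context {R : realType} {n : nat}.
Notation V := ('rV[R]_n).
Notation mu := (lebesgue_rV R n).
Implicit Types (u w g : V -> R) (U W K Omega C : set V) (e : V) (G : V -> V).

Lemma weak_derive_ae C e u g g' : weak_derive C e u g ->
  mu.-integrable setT (EFin \o g') -> {ae mu, forall x, g x = g' x} ->
  weak_derive C e u g'.
Proof.
move=> [ui gi h] g'i gg'; split => // psi cpsi; rewrite h//; congr (- _).
have mpsi := C1c_measurable cpsi.
apply: Rintegral_ae_eq => //.
- by apply: measurable_funM => //; exact: integrable_measurable.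
- by apply: measurable_funM => //; exact: integrable_measurable.
- by apply: filterS gg' => x -> _.
Qed.

(** Near [x0] the function is invariant under all small translations, since its line
    averages vanish. *)
Lemma weak_grad0_locally_const Omega w G x0 : open Omega -> weak_grad Omega w G ->
  {ae mu, forall x, Omega x -> G x = 0} -> Omega x0 ->
  exists c, exists2 W, nbhs x0 W & {ae mu, forall x, W x -> w x = c}.
Proof.
move=> oO wG G0 Ox0.
have [r r0 rO] : exists2 r : R, 0 < r & thicken [set x0] r `<=` Omega.
  by apply: compact_thicken_sub => //; [exact: compact_set1|move=> _ ->].
(* a point at distance [rho] moved by less than [2 rho] stays within [r] *)
pose K := thicken [set x0] r; pose rho := r / 4.
have rho0 : 0 < rho by rewrite divr_gt0.
have cK : compact K by apply: compact_thicken; exact: compact_set1.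
have i0 : mu.-integrable setT (EFin \o (cst 0 : V -> R)) by exact: integrable0.
have wdi i : weak_derive K (delta_mx ord0 i) (w \_ K) (cst 0).
  apply: (weak_derive_ae (weak_grad_local i cK rO wG) i0).
  apply: filterS G0 => x hx; rewrite patchE /Defs.coord /=.
  by case: ifPn => //; rewrite inE => /rO/hx ->; rewrite mxE.
have [ui mwK] : mu.-integrable setT (EFin \o (w \_ K)) /\ measurable_fun setT (w \_ K).
  have ui : mu.-integrable setT (EFin \o (w \_ K)).
    have [[_ wL] _ _] := wG; apply: L1_restrict; last exact: wL.
    exact: compact_measurable_rV.
  by split => //; exact: integrable_measurable.
have inK x : `|x - x0| <= r -> K x by move=> h; exists x0.
have inv e : `|e| < 2 * rho ->
    {ae mu, forall x, ball x0 rho x -> (w \_ K) (x + e) = (w \_ K) x}.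
  move=> e2.
  have := @translate_weak_derive _ _ K (ball x0 rho) e (w \_ K) (cst 0)
    (ball_open _ _) (weak_derive0_all ui wdi e).
  have UC x t : ball x0 rho x -> 0 <= t <= 1 -> K (x + t *: e).
    rewrite -ball_normE /= distrC => xB /andP[t0 t1]; apply: inK.
    rewrite addrAC (le_trans (ler_normD _ _))// normrZ ger0_norm//.
    have : t * `|e| <= 2 * rho by rewrite (le_trans _ (ltW e2))// ler_piMl.
    by rewrite /rho in xB e2 *; lra.
  move=> /(_ UC); apply: filterS => x hx /hx /eqP.
  by rewrite /line_average Rintegral_cst// mul0r subr_eq0 => /eqP.
have [c hc] := ae_const_translation_invariant rho0 mwK inv.
exists c, (ball x0 rho); first exact: nbhsx_ballx.
apply: filterS hc => x hx xB; rewrite -hx// patchE mem_set//.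
apply: inK; move: xB; rewrite -ball_normE /= distrC => /ltW/le_trans; apply.
by rewrite /rho; lra.
Qed.

(** The local values are unique, because nonempty open sets are not null; so the sets
    where a given value is taken are open and disjoint, and by connectedness one of
    them is the whole domain. *)
Theorem weak_grad0_const Omega w G : open Omega -> connected Omega -> Omega !=set0 ->
  weak_grad Omega w G -> {ae mu, forall x, Omega x -> G x = 0} ->
  exists c, {ae mu, forall x, Omega x -> w x = c}.
Proof.
move=> oO cO [x0 Ox0] wG G0.
pose near_const (c : R) (x : V) := exists2 W, nbhs x W & {ae mu, forall y, W y -> w y = c}.
have loc x : Omega x -> exists c, near_const c x.
  by move=> Ox; exact: weak_grad0_locally_const wG G0 Ox.
have uniq_c x c c' : near_const c x -> near_const c' x -> c = c'.
  move=> [W Wx Wc] [W' Wx' Wc'].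
  have : nbhs x (W `&` W') by exact: filterI.
  rewrite nbhsE => -[Z [oZ Zx] ZW].
  have mZ := open_measurable_rV oZ.
  have [|z Zz [<- <-]//] := ae_witness mZ (lebesgue_nbhs_gt0 mZ (open_nbhs_nbhs (conj oZ Zx)))
    (P := fun z => w z = c /\ w z = c').
  by apply: filterS2 Wc Wc' => z h h' /ZW[/h ? /h' ?].
have open_near c : open (near_const c).
  rewrite openE => x [W]; rewrite nbhsE => -[Z [oZ Zx] ZW] Wc.
  rewrite /interior nbhsE; exists Z => // y Zy; exists Z.
    exact: open_nbhs_nbhs.
  by apply: filterS Wc => z h /ZW.
have [c0 hc0] := loc _ Ox0.
have E : Omega `&` near_const c0 = Omega.
  apply: cO.
  - by exists x0.
  - by exists (near_const c0).
  - exists (~` \bigcup_(c in [set c | c != c0]) near_const c).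
      by rewrite closedC; apply: bigcup_open => c _.
    apply/seteqP; split => x [Ox h]; split => //.
      by move=> [c /= cc0 /(uniq_c _ _ _ h) cE]; rewrite cE eqxx in cc0.
    have [c hc] := loc _ Ox.
    have [<-//|cc0] := eqVneq c c0.
    by exfalso; apply: h; exists c.
exists c0; apply: ae_of_local => x; rewrite -E => -[_ [W Wx hW]].
by exists W.
Qed.

Section chain_rule.
Variables (Phi dPhi : R -> R) (M B : R).
Hypothesis dPhiP : forall s : R, is_derive s 1 Phi (dPhi s).
Hypothesis cdPhi : continuous dPhi.
Hypothesis dPhiM : forall s, `|dPhi s| <= M.
Hypothesis PhiB : forall s, `|Phi s| <= B.

(** A test function only sees a compact part of the domain: [C] contains the support
    [K] with a margin [r], and the steps along which the whole-space chain rule is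
    applied are short enough to keep a neighbourhood [U] of [K] inside [C]. *)
Theorem weak_grad_comp Omega w G : open Omega -> weak_grad Omega w G ->
  weak_grad Omega (Phi \o w) (fun x => dPhi (w x) *: G x).
Proof.
move=> oO wG; have [[mw wL] GL h] := wG.
have mO := open_measurable_rV oO.
have mPhi := continuous_measurable_fun (continuous_primitive dPhiP).
have mdPhi := continuous_measurable_fun cdPhi.
have mPw : measurable_fun Omega (Phi \o w) by exact: (measurableT_comp mPhi).
have mdPw : measurable_fun Omega (dPhi \o w) by exact: (measurableT_comp mdPhi).
split.
- split => // K cK KO; have mK := compact_measurable_rV cK.
  apply: (integrable_bounded mK _ (measurable_funS mO KO mPw) (fun x _ => PhiB (w x))).
  by apply: lebesgue_bounded_lty => //; exact: compact_bounded.
- move=> i; have [mG GLi] := GL i.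
  have E : Defs.coord (fun x => dPhi (w x) *: G x) i =
      (fun x => Defs.coord G i x * dPhi (w x)).
    by apply/funext => x; rewrite /Defs.coord mxE mulrC.
  split; first by rewrite E; exact: measurable_funM.
  move=> K cK KO; have mK := compact_measurable_rV cK.
  rewrite E; apply: (integrable_mul_bounded mK (GLi K cK KO) _ (fun x _ => dPhiM (w x))).
  exact: (measurable_funS mO KO mdPw).
move=> phi cphi i; have [dphi _ [K [cK KO p0]]] := cphi.
have [r r0 rO] := compact_thicken_sub cK oO KO.
pose C := thicken K r.
have cC : compact C by exact: compact_thicken.
pose U := \bigcup_(y in K) ball y (r / 2).
have r20 : 0 < r / 2 by rewrite divr_gt0.
have oU : open U by apply: bigcup_open => y _; exact: ball_open.
have cphiU : C1c U phi.
  have [? ? _] := cphi; split => //; exists K; split => // y Ky.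
  by exists y => //; exact: ballxx.
pose e := delta_mx ord0 i : V.
pose r' := r / 2 / (`|e| + 1).
have e1 : 0 < `|e| + 1 by rewrite ltr_wpDl.
have r'0 : 0 < r' by rewrite divr_gt0.
have UC x s : U x -> `|s| <= r' -> C (x + s *: e).
  move=> [y Ky]; rewrite -ball_normE /= distrC => xy sr.
  exists y => //; rewrite addrAC (le_trans (ler_normD _ _))// (splitr r) lerD ?(ltW xy)//.
  rewrite normrZ (@le_trans _ _ (r' * (`|e| + 1)))//.
    by apply: ler_pM => //; rewrite lerDl.
  by rewrite divfK// gt_eqF.
have := chain_rule_weak_derive dPhiP cdPhi dPhiM PhiB oU
  (weak_grad_local i cC rO wG) r'0 UC cphiU.
have KC : K `<=` C by apply: thicken_self; exact: ltW.
rewrite [in X in _ -> X = _]Rintegral_mkcond [in X in _ -> _ = - X]Rintegral_mkcond.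
move=> H; transitivity (\int[mu]_x (Phi ((w \_ C) x) * 'D_e phi x)).
  apply: eq_Rintegral => x _; rewrite !patchE.
  have [Kx|nKx] := pselect (K x).
    by rewrite (mem_set (KO _ Kx)) (mem_set (KC _ Kx)) /Defs.coord /grad mxE.
  rewrite (derive_support e cK p0)// mulr0; case: ifPn => // _.
  by rewrite /Defs.coord /grad mxE (derive_support e cK p0)// mulr0.
rewrite H; congr (- _); apply: eq_Rintegral => x _; rewrite !patchE.
have [Kx|nKx] := pselect (K x).
  by rewrite (mem_set (KO _ Kx)) (mem_set (KC _ Kx)) /Defs.coord mxE.
by rewrite p0// mulr0; case: ifPn => // _; rewrite mulr0.
Qed.

End chain_rule.

End weak_gradients.

(** * A bounded function whose derivative is dominated by the coefficient *)

Lemma is_derive_opp_inv {R : realType} (f : R -> R) (s df : R) : f s != 0 ->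
  is_derive s 1 f df -> is_derive s 1 (fun t => - (f t)^-1) (df / f s ^+ 2).
Proof.
move=> f0 [d1 d2].
have h : is_derive s 1 (fun t => (f t)^-1) (- (df / f s ^+ 2)).
  apply: DeriveDef; first exact: derivableV.
  rewrite (deriveV f0 d1) d2 -[_ *: _]/(_ * _) mulNr; congr (- _).
  by rewrite mulrC.
by have := is_deriveN h; rewrite opprK.
Qed.

Section absorbing_function.
Context {R : realType}.
Notation leb := (@lebesgue_measure R).
Variable kappa : R -> R.
Hypothesis hkappa : degenerate_coefficient kappa.

(** The coefficient is continuous on the closed half line only; composing with the
    positive part gives a function that is continuous everywhere and has the same
    values at nonnegative arguments. *)
Lemma continuous_coefficient : continuous (fun s : R => kappa (Num.max s 0)).
Proof.
case: hkappa => /subspace_continuousP ck _ _ s.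
have s0 (t : R) : `[0, +oo[%classic (Num.max t 0).
  by rewrite /= in_itv /= andbT le_max lexx orbT.
have cm : Num.max t 0 @[t --> s] --> within `[0, +oo[%classic (nbhs (Num.max s 0)).
  have cmax : Num.max t 0 @[t --> s] --> Num.max s 0 by exact: continuous_pos_part.
  move=> P hP; change (nbhs s (fun t => P (Num.max t 0))).
  have h : nbhs s (fun t : R => `[0, +oo[%classic (Num.max t 0) -> P (Num.max t 0)).
    exact: (cmax _ hP).
  by apply: filterS h => t; apply; exact: s0.
exact: cvg_comp cm (ck _ (s0 s)).
Qed.

Let k (s : R) := kappa (Num.max s 0).

Let k_ge0 s : 0 <= k s.
Proof.
case: hkappa => _ k0 kpos; rewrite /k; case: (leP s 0) => s0; first by rewrite k0.
exact: ltW (kpos _ s0).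
Qed.

(** Bounded by 1 and by the coefficient at once. *)
Let rho (s : R) := k s / (1 + k s).

Let k1_gt0 s : 0 < 1 + k s. Proof. by rewrite ltr_pwDl. Qed.

Let crho : continuous rho.
Proof.
move=> s; apply: cvgM; first exact: continuous_coefficient.
apply: cvgV; first by rewrite gt_eqF.
by apply: cvgD; [exact: cvg_cst|exact: continuous_coefficient].
Qed.

Let rho_ge0 s : 0 <= rho s. Proof. by rewrite divr_ge0// ltW. Qed.

Let rho_le1 s : rho s <= 1.
Proof. by rewrite ler_pdivrMr// mul1r lerDr. Qed.

Let rho_lek s : rho s <= k s.
Proof. by rewrite ler_pdivrMr// ler_peMr// lerDl. Qed.

Let rho_gt0 s : 0 < s -> 0 < rho s.
Proof.
case: hkappa => _ _ kpos s0.
by apply: divr_gt0 => //; rewrite /k max_l ?kpos// ltW.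
Qed.

Let rho0 s : s <= 0 -> rho s = 0.
Proof. by case: hkappa => _ k0 _ s0; rewrite /rho /k max_r// k0 mul0r. Qed.

Let irho u : leb.-integrable `]-oo, u] (EFin \o rho).
Proof.
have mI : measurable (`]-oo, u]%classic : set (measurableTypeR R)) by exact: measurable_itv.
apply: (@le_integrable _ _ _ leb _ mI _ (EFin \o (\1_(`[0, u]%classic)))).
- apply/measurable_EFinP; apply: measurable_funTS; exact: continuous_measurable_fun.
- move=> s /=; rewrite in_itv /= => su; rewrite lee_fin !ger0_norm// indicE.
  have [s0|s0] := leP s 0; first by rewrite rho0.
  by rewrite mem_set//= in_itv /= (ltW s0) su.
- apply: integrableS (_ : leb.-integrable setT _) => //.
  apply/integrableP; split.
    by apply/measurable_EFinP; apply: measurable_indic; exact: measurable_itv.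
  under eq_integral => x _ do rewrite /= ger0_norm//.
  rewrite integral_indic//.
  rewrite setIT [X in (X < _)%E](lebesgue_measure_itv `[0, u]) /=.
  by case: ifP => _; rewrite ?ltry// -EFinB ltry.
Qed.

(** The integrand vanishes on the negative half line, so this is its primitive that
    is 0 on that half line. *)
Let K (s : R) := \int[leb]_(t in `]-oo, s]) rho t.

Let dK (s : R) : is_derive s 1 K (rho s).
Proof.
have cs : {for s, continuous rho} by exact: crho.
have ss : s < s + 1 by rewrite ltrDl.
have [|d1 d2] := @continuous_FTC1 R rho _ s (s + 1) ss (irho (s + 1)) _ cs.
  exact: ltNyr.
by split; [exact: d1|move: d2; rewrite derive1E].
Qed.

Let K_ge0 s : 0 <= K s. Proof. by apply: Rintegral_ge0. Qed.

Let K1_gt0 s : 0 < 1 + K s. Proof. by rewrite ltr_pwDl. Qed.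

Let cK : continuous K.
Proof.
move=> s; apply: differentiable_continuous; apply/derivable1_diffP.
by have [] := dK s.
Qed.

Let K_lt a b : 0 <= a -> a < b -> K a < K b.
Proof.
move=> a0 ab.
have [c] := MVT ab (fun x _ => dK x) (continuous_subspaceT cK).
rewrite in_itv /= => /andP[ac cb] h.
rewrite -subr_gt0 h mulr_gt0 ?subr_gt0// rho_gt0//.
exact: le_lt_trans ac.
Qed.

(** Take [Phi = - 1 / (1 + K)], where [K] is the primitive of
    [rho = kappa / (1 + kappa)]: it is increasing where [K] is, bounded even if [K]
    is not, and its derivative [rho / (1 + K)^2] is at most [rho], hence at most 1
    and at most [kappa]. *)
Lemma absorbing_function : exists Phi p : R -> R,
  [/\ (forall s : R, is_derive s 1 Phi (p s)) /\ continuous p,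
      (forall s, `|Phi s| <= 1) /\ (forall s, `|p s| <= 1),
      forall s, 0 <= s -> 0 <= p s <= kappa s,
      forall s, 0 < s -> 0 < p s &
      forall a b, 0 <= a -> 0 <= b -> Phi a = Phi b -> a = b].
Proof.
pose p s := rho s / (1 + K s) ^+ 2.
have q1 s : 1 <= (1 + K s) ^+ 2 by rewrite expr_ge1// ?lerDl// ltW.
have p_ge0 s : 0 <= p s by rewrite divr_ge0// exprn_ge0// ltW.
have p_le s : p s <= rho s.
  by rewrite ler_pdivrMr ?exprn_gt0// ler_peMr.
exists (fun s => - (1 + K s)^-1), p; split.
- split=> [s|s].
    have dK1 : is_derive s 1 (fun s => 1 + K s) (rho s).
      have := is_deriveD (is_derive_cst (1 : R) s 1) (dK s).
      by rewrite add0r.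
    by apply: is_derive_opp_inv dK1; rewrite gt_eqF.
  apply: cvgM; first exact: crho.
  apply: cvgV; first by rewrite gt_eqF// exprn_gt0.
  rewrite expr2; under eq_fun do rewrite expr2.
  by apply: cvgM; apply: cvgD; (exact: cvg_cst || exact: cK).
- split=> s.
    by rewrite normrN normfV (ger0_norm (ltW (K1_gt0 s))) invf_le1 ?K1_gt0// lerDl.
  by rewrite ger0_norm ?p_ge0// (le_trans (p_le s)).
- move=> s s0; rewrite p_ge0 (le_trans (p_le s))//.
  by rewrite (le_trans (rho_lek s))// /k max_l.
- by move=> s s0; rewrite divr_gt0 ?exprn_gt0// rho_gt0.
move=> a b a0 b0 /oppr_inj /invr_inj /addrI Kab.
by case: (ltgtP a b) => // [/(K_lt a0)|/(K_lt b0)]; rewrite Kab ltxx.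
Qed.

End absorbing_function.

(** * Integrands that vanish almost everywhere *)

Section vanishing_fluxes.
Context {R : realType} {n : nat}.
Notation V := ('rV[R]_n).
Notation mu := (lebesgue_rV R n).
Implicit Types (u v w f g : V -> R) (Omega D K : set V) (e : V) (F G : V -> V).

Lemma integrable_ae0 D f : measurable D -> measurable_fun D f ->
  {ae mu, forall x, D x -> f x = 0} -> mu.-integrable D (EFin \o f).
Proof.
move=> mD mf f0; have mEf : measurable_fun D (EFin \o f) by exact/measurable_EFinP.
apply/integrableP; split => //.
rewrite (proj2 (ae_eq_integral_abs mu mD mEf)) ?ltry//.
by apply: filterS f0 => x h Dx /=; rewrite h.
Qed.

Lemma Rintegral_ae0 D f : measurable D -> measurable_fun D f ->
  {ae mu, forall x, D x -> f x = 0} -> \int[mu]_(x in D) f x = 0.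
Proof.
move=> mD mf f0; rewrite (@Rintegral_ae_eq _ _ _ mu D f (cst 0))//.
exact: Rintegral0.
Qed.

Lemma Rintegral_eq0_ae D f : measurable D -> mu.-integrable D (EFin \o f) ->
  (forall x, D x -> 0 <= f x) -> \int[mu]_(x in D) f x = 0 ->
  {ae mu, forall x, D x -> f x = 0}.
Proof.
move=> mD fi f0 I0.
have mEf : measurable_fun D (EFin \o f) by exact: measurable_int fi.
have : (\int[mu]_(x in D) `|(EFin \o f) x| = 0)%E.
  under eq_integral => x /set_mem Dx do rewrite gee0_abs ?lee_fin ?f0//.
  by rewrite -[LHS]fineK ?integrable_fin_num//; congr EFin.
move=> /(ae_eq_integral_abs mu mD mEf); apply: filterS => x h Dx.
by have [] := h Dx.
Qed.

Lemma measurable_dotv D F G : (forall i, measurable_fun D (Defs.coord F i)) ->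
  (forall i, measurable_fun D (Defs.coord G i)) ->
  measurable_fun D (fun x => dotv (F x) (G x)).
Proof.
by move=> mF mG; apply: measurable_sum => i; apply: measurable_funM; [exact: mF|exact: mG].
Qed.

Lemma dotv_ge0 (x : V) : 0 <= dotv x x.
Proof. by apply: sumr_ge0 => i _; rewrite -expr2 sqr_ge0. Qed.

Lemma dotv_eq0 (x : V) : dotv x x = 0 -> x = 0.
Proof.
move=> /eqP; rewrite psumr_eq0 => [/allP h|i _]; last by rewrite -expr2 sqr_ge0.
apply/rowP => i; have := h i (mem_index_enum _).
by rewrite mxE -expr2 sqrf_eq0 => /eqP.
Qed.

Lemma measurable_coord_grad Omega phi i : C1c Omega phi ->
  measurable_fun setT (Defs.coord (grad phi) i).
Proof.
move=> cphi; have := C1c_derive_measurable (delta_mx ord0 i) cphi.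
by under [X in _ -> measurable_fun _ X]eq_fun do rewrite /Defs.coord /grad mxE.
Qed.

(** The derivative is the limit of difference quotients, whose integrals vanish by
    translation invariance: no boundary term arises. *)
Lemma integral_derive_test Omega phi e : C1c Omega phi ->
  \int[mu]_x 'D_e phi x = 0.
Proof.
move=> cphi; have iphi := integrable_test cphi.
have dc (s : R) : is_derive s 1 (cst (1 : R)) 0 by exact: is_derive_cst.
have B1 (s : R) : `|cst (1 : R) s| <= 1 by rewrite normr1.
have mc : measurable_fun setT (cst (0 : R) : V -> R) by exact: measurable_cst.
have hn0 k : harmonic k != 0 :> R by rewrite gt_eqF// harmonic_gt0.
have hle k : `|harmonic k : R| <= 1.
  by rewrite ger0_norm ?harmonic_ge0// /harmonic /= invf_le1 ?ler1n.
(* [Phi = 1], and the steps [1 / (k + 1)] *)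
have := @test_increment_integral_cvg R n (cst 1) (cst 0) 1 dc B1 Omega (cst 0) e phi
  harmonic 1 cphi mc ler01 cvg_harmonic hn0 hle.
have -> : (fun k => \int[mu]_x (cst 1 (cst (0 : R) x) *
    ((phi (x + harmonic k *: e) - phi x) / harmonic k))) = cst 0.
  apply/funext => k /=.
  under eq_Rintegral do rewrite mul1r.
  have ite := integrable_translate (harmonic k *: e) iphi.
  rewrite RintegralZr//; last by have := integrableB measurableT ite iphi.
  by rewrite RintegralB// Rintegral_translate// subrr mul0r.
under [X in _ --> X]eq_Rintegral do rewrite /= mul1r.
by move=> h; apply/esym; exact: cvg_unique (cvg_cst (0 : R)) h.
Qed.

Lemma weak_grad_const Omega v (c : R) : open Omega -> L1loc Omega v ->
  {ae mu, forall x, Omega x -> v x = c} -> weak_grad Omega v (cst 0).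
Proof.
move=> oO vL vc; have mO := open_measurable_rV oO.
have E i : Defs.coord (cst (0 : V)) i = cst 0.
  by apply/funext => x; rewrite /Defs.coord mxE.
split => //.
  move=> i; rewrite E; split => // K cK _; apply: integrable0.
move=> phi cphi i.
have mD := measurable_funS measurableT (@subsetT _ Omega) (measurable_coord_grad i cphi).
under [in RHS]eq_Rintegral do rewrite E mul0r.
rewrite Rintegral0 oppr0.
rewrite (@Rintegral_ae_eq _ _ _ mu Omega _ (fun x => c * Defs.coord (grad phi) i x))//.
- have [dphi _ [K [cK KO p0]]] := cphi.
  rewrite Rintegral_mkcond.
  transitivity (\int[mu]_x (c * 'D_(delta_mx ord0 i) phi x)).
    apply: eq_Rintegral => x _; rewrite patchE /Defs.coord /grad mxE.
    case: ifPn => //; rewrite notin_setE => nOx.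
    by rewrite (derive_support _ cK p0) ?mulr0// => /KO.
  rewrite RintegralZl//; first by rewrite (integral_derive_test _ cphi) mulr0.
  exact: integrable_derive_test cphi.
- by apply: measurable_funM => //; case: vL.
- exact: measurable_funM.
- by apply: filterS vc => x h Ox; rewrite h.
Qed.

End vanishing_fluxes.

(** * Steady states with vanishing fluxes, and the conserved quantities *)

Section steady_states.
Context {R : realType} {n : nat}.
Notation V := ('rV[R]_n).
Notation mu := (lebesgue_rV R n).
Implicit Types (u v w f g : V -> R) (Omega D K : set V) (e : V) (F G : V -> V).

Lemma coefficient_ge0 (eta : R -> R) (s : R) : degenerate_coefficient eta ->
  0 <= s -> 0 <= eta s.
Proof.
move=> [_ eta0 etapos]; rewrite le_eqVlt => /predU1P[<-|/etapos/ltW//].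
by rewrite eta0.
Qed.

Lemma measurable_coefficient (eta : R -> R) Omega w : degenerate_coefficient eta ->
  measurable_fun Omega w -> (forall x, Omega x -> 0 <= w x) ->
  measurable_fun Omega (fun x => eta (w x)).
Proof.
move=> heta mw w0.
apply: (@eq_measurable_fun _ _ _ _ _ (fun x => eta (Num.max (w x) 0))).
  by move=> x /set_mem Ox; rewrite max_l// w0.
exact: (measurableT_comp (continuous_measurable_fun (continuous_coefficient heta)) mw).
Qed.

(** If both fluxes vanish almost everywhere, so does the dissipation, which is the
    scalar product of [eta(w) grad v] with [grad v]; every integral in the weak
    formulation is then 0. *)
Lemma steady_state_flux0 (eta kappa : R -> R) Omega v w Gv Gw :
  degenerate_coefficient eta -> degenerate_coefficient kappa -> open Omega ->
  (forall x, Omega x -> 0 <= w x) -> weak_grad Omega v Gv -> weak_grad Omega w Gw ->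
  {ae mu, forall x, Omega x -> eta (w x) *: Gv x = 0} ->
  {ae mu, forall x, Omega x -> kappa (w x) *: Gw x = 0} ->
  steady_state eta kappa Omega v w.
Proof.
move=> heta hkappa oO w0 wGv wGw Fv0 Fw0; have mO := open_measurable_rV oO.
have [_ GvL _] := wGv; have [[mw _] GwL _] := wGw.
have meta := measurable_coefficient heta mw w0.
have mkappa := measurable_coefficient hkappa mw w0.
have mFv i : measurable_fun Omega (Defs.coord (fun x => eta (w x) *: Gv x) i).
  rewrite (_ : Defs.coord _ i = (fun x => eta (w x) * Defs.coord Gv i x)).
    by apply: measurable_funM => //; have [] := GvL i.
  by apply/funext => x; rewrite /Defs.coord mxE.
have mFw i : measurable_fun Omega (Defs.coord (fun x => kappa (w x) *: Gw x) i).
  rewrite (_ : Defs.coord _ i = (fun x => kappa (w x) * Defs.coord Gw i x)).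
    by apply: measurable_funM => //; have [] := GwL i.
  by apply/funext => x; rewrite /Defs.coord mxE.
have mdiss : measurable_fun Omega (fun x => eta (w x) * dotv (Gv x) (Gv x)).
  by apply: measurable_funM => //; apply: measurable_dotv => i; have [] := GvL i.
have diss0 : {ae mu, forall x, Omega x -> eta (w x) * dotv (Gv x) (Gv x) = 0}.
  apply: filterS Fv0 => x h Ox.
  rewrite /dotv mulr_sumr big1// => i _; rewrite mulrA.
  by have := congr1 (fun y : V => y ord0 i) (h Ox); rewrite !mxE => ->; rewrite mul0r.
have L1loc0 f : measurable_fun Omega f -> {ae mu, forall x, Omega x -> f x = 0} ->
    L1loc Omega f.
  move=> mf f0; split => // K cK KO; apply: integrable_ae0.
  - exact: compact_measurable_rV.
  - exact: measurable_funS mf.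
  - by apply: filterS f0 => x h /KO/h.
have L20 f : measurable_fun Omega f -> {ae mu, forall x, Omega x -> f x = 0} ->
    L2 Omega f.
  move=> mf f0; split => //; apply: integrable_ae0 => //.
    exact: measurable_funX.
  by apply: filterS f0 => x h /h ->; rewrite expr0n.
have coord0 F i : {ae mu, forall x, Omega x -> F x = 0} ->
    {ae mu, forall x, Omega x -> Defs.coord F i x = 0}.
  by apply: filterS => x h /h; rewrite /Defs.coord => ->; rewrite mxE.
have dot0 F G : (forall i, measurable_fun Omega (Defs.coord F i)) ->
    (forall i, measurable_fun Omega (Defs.coord G i)) ->
    {ae mu, forall x, Omega x -> F x = 0} ->
    \int[mu]_(x in Omega) dotv (F x) (G x) = 0.
  move=> mF mG F0; apply: Rintegral_ae0 => //; first exact: measurable_dotv.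
  apply: filterS F0 => x h /h ->; rewrite /dotv big1// => i _.
  by rewrite mxE mul0r.
have mul0 g phi : measurable_fun Omega g -> measurable_fun Omega phi ->
    {ae mu, forall x, Omega x -> g x = 0} ->
    \int[mu]_(x in Omega) (g x * phi x) = 0.
  move=> mg mphi g0; apply: Rintegral_ae0 => //; first exact: measurable_funM.
  by apply: filterS g0 => x h /h ->; rewrite mul0r.
have mtest phi : C1c Omega phi -> measurable_fun Omega phi.
  by move=> /C1c_measurable; exact: measurable_funS.
have mgrad phi i : C1c Omega phi -> measurable_fun Omega (Defs.coord (grad phi) i).
  by move=> /(measurable_coord_grad i); exact: measurable_funS.
have div0 F g : (forall i, measurable_fun Omega (Defs.coord F i)) ->
    measurable_fun Omega g -> {ae mu, forall x, Omega x -> F x = 0} ->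
    {ae mu, forall x, Omega x -> g x = 0} -> weak_div Omega F g /\ no_flux Omega F g.
  move=> mF mg F0 g0; split.
    split=> [i||phi cphi]; [exact: (L1loc0 _ (mF i) (coord0 _ i F0))|exact: L1loc0|].
    by rewrite dot0 ?mul0 ?oppr0//; [exact: mtest|move=> i; exact: mgrad].
  move=> phi G [[[mphi _] GL _] _ _] _; rewrite /normal_trace dot0 ?mul0 ?addr0//.
  by move=> i; have [] := GL i.
have [dv nv] : weak_div Omega (fun x => eta (w x) *: Gv x) (cst 0) /\
    no_flux Omega (fun x => eta (w x) *: Gv x) (cst 0).
  by apply: div0 => //; exact: aeW.
have [dw nw] : weak_div Omega (fun x => kappa (w x) *: Gw x)
      (\- (fun x => eta (w x) * dotv (Gv x) (Gv x))) /\
    no_flux Omega (fun x => kappa (w x) *: Gw x)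
      (\- (fun x => eta (w x) * dotv (Gv x) (Gv x))).
  apply: div0 => //; first exact: measurable_funN.
  by apply: filterS diss0 => x h /h /= ->; rewrite oppr0.
exists Gv, Gw; split => //; split => //.
- by move=> i; apply: L20 => //; exact: coord0.
- by move=> i; apply: L20 => //; exact: coord0.
- exact: integrable_ae0.
Qed.

Section bounded_domain.
Variables (Omega : set V).
Hypotheses (oO : open Omega) (bO : bounded_set Omega) (nO : Omega !=set0).

Let mO : measurable Omega. Proof. exact: open_measurable_rV. Qed.
Let Ofin : (mu Omega < +oo)%E. Proof. exact: lebesgue_bounded_lty. Qed.
Let Opos : (0 < mu Omega)%E.
Proof.
by case: nO => x Ox; apply: (lebesgue_nbhs_gt0 mO (x := x)); exact: open_nbhs_nbhs.
Qed.

Lemma volume_gt0 : 0 < volume Omega.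
Proof. by rewrite fine_gt0// Opos Ofin. Qed.

Lemma L2_bounded f (M : R) : measurable_fun Omega f ->
  (forall x, Omega x -> `|f x| <= M) -> L2 Omega f.
Proof.
move=> mf fM; split => //.
apply: (integrable_bounded (M := M ^+ 2) mO Ofin); first exact: measurable_funX.
move=> x Ox; rewrite normrX lerXn2r ?nnegrE//; last exact: fM.
by apply: le_trans (fM _ Ox).
Qed.

Lemma H1_grad_one : H1_grad Omega (cst 1) (cst 0).
Proof.
have m1 : measurable_fun Omega (cst 1 : V -> R) by [].
split.
- apply: (@weak_grad_const _ _ _ _ 1) => //; last exact: aeW.
  split => // K cK KO.
  apply: integrableS (integrable_bounded mO Ofin m1 (M := 1) _) => //.
    exact: compact_measurable_rV.
  by move=> x _ /=; rewrite normr1.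
- by apply: (@L2_bounded _ 1) => // x _; rewrite normr1.
- move=> i; apply: (@L2_bounded _ 0).
    rewrite (_ : Defs.coord _ i = cst 0)//.
    by apply/funext => x; rewrite /Defs.coord mxE.
  by move=> x _; rewrite /Defs.coord mxE normr0.
Qed.

Lemma conserved_const v w (a b : R) (p : R * R) : measurable_fun Omega v ->
  measurable_fun Omega w -> {ae mu, forall x, Omega x -> v x = a} ->
  {ae mu, forall x, Omega x -> w x = b} ->
  conserved Omega v w p <-> p = (volume Omega * a, volume Omega * b).
Proof.
move=> mv mw va wb; rewrite /conserved.
have vol0 := volume_gt0.
have fv : mu Omega = (volume Omega)%:E by rewrite /volume fineK// ge0_fin_numE.
have -> : (\int[mu]_(x in Omega) (v x)%:E = (volume Omega * a)%:E)%E.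
  rewrite (ae_eq_integral (cst a%:E))//.
  - by rewrite integral_cst// fv -EFinM mulrC.
  - exact/measurable_EFinP.
  - by apply: filterS va => x h /h ->.
have -> : (\int[mu]_(x in Omega) (2^-1 * v x ^+ 2 + w x)%:E =
    (volume Omega * (2^-1 * a ^+ 2 + b))%:E)%E.
  rewrite (ae_eq_integral (cst (2^-1 * a ^+ 2 + b)%:E))//.
  - by rewrite integral_cst// fv -EFinM mulrC.
  - apply/measurable_EFinP; apply: measurable_funD => //; apply: measurable_funM => //.
    exact: measurable_funX.
  - by apply: filterS2 va wb => x h h' Ox; rewrite h// h'.
case: p => p1 p2 /=.
have E : (2 * volume Omega)^-1 * (volume Omega * a) ^+ 2 =
    volume Omega * (2^-1 * a ^+ 2).
  by field; rewrite gt_eqF.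
split=> [[[h1] [h2]]|[-> ->]].
  move: h2; rewrite -h1 E mulrDr addrC => /addIr ->.
  by [].
by rewrite E -mulrDr addrC.
Qed.

End bounded_domain.

End steady_states.

(** * Constancy of the energy density of a steady state *)

Section constancy.
Context {R : realType} {n : nat}.
Notation V := ('rV[R]_n).
Notation mu := (lebesgue_rV R n).
Variables (Omega : set V) (eta kappa : R -> R) (v w : V -> R).
Hypotheses (oO : open Omega) (cO : connected Omega) (nO : Omega !=set0)
  (bO : bounded_set Omega).
Hypotheses (heta : degenerate_coefficient eta) (hkappa : degenerate_coefficient kappa).

Let mO : measurable Omega. Proof. exact: open_measurable_rV. Qed.

(** Integrating the equation over the domain: the constant 1 is admissible because the
    domain is bounded, and it turns the no-flux condition into the vanishing of the
    integral of a nonnegative function. *)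
Lemma dissipation_eq0 F diss : L1 Omega diss -> (forall x, Omega x -> 0 <= diss x) ->
  no_flux Omega F (\- diss) -> {ae mu, forall x, Omega x -> diss x = 0}.
Proof.
move=> idiss diss0 /(_ (cst 1) (cst 0) (H1_grad_one oO bO)) trace1.
apply: Rintegral_eq0_ae => //.
have : Linfty Omega (cst 1 : V -> R).
  by split=> //; exists 1; apply: aeW => x _; rewrite normr1.
move=> /trace1; rewrite /normal_trace.
under eq_Rintegral => x _.
  rewrite (_ : dotv (F x) _ = 0); last first.
    by rewrite /dotv big1// => i _; rewrite mxE mulr0.
  over.
rewrite Rintegral0 add0r (_ : Rintegral _ _ _ = \int[mu]_(x in Omega) (-1 * diss x)).
  by rewrite RintegralZl// mulN1r => /eqP; rewrite oppr_eq0 => /eqP.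
by apply: eq_Rintegral => x _ /=; rewrite mulr1 mulN1r.
Qed.

(** The equation of [w], now without source, is tested with [Phi(w)]. *)
Lemma steady_state_w_const : steady_state eta kappa Omega v w ->
  exists c, [/\ 0 <= c, {ae mu, forall x, Omega x -> w x = c} &
    exists2 Gv, weak_grad Omega v Gv &
      {ae mu, forall x, Omega x -> eta (w x) * dotv (Gv x) (Gv x) = 0}].
Proof.
move=> [Gv [Gw [w0 [wGv wGw] [_ L2Fw idiss] _ [_ noflux]]]].
have [[mw _] GwL _] := wGw.
have diss_ge0 x : Omega x -> 0 <= eta (w x) * dotv (Gv x) (Gv x).
  by move=> Ox; rewrite mulr_ge0 ?dotv_ge0// coefficient_ge0// w0.
have diss0 := dissipation_eq0 idiss diss_ge0 noflux.
have mdiss : measurable_fun Omega (fun x => eta (w x) * dotv (Gv x) (Gv x)).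
  by apply/measurable_EFinP; exact: measurable_int idiss.
have [Phi [p [[dPhi cp] [PhiB pB] p_kappa p_gt0 Phi_inj]]] := absorbing_function hkappa.
have wGPhi := weak_grad_comp dPhi cp pB PhiB oO wGw.
have mPhi := continuous_measurable_fun (continuous_primitive dPhi).
have mp := continuous_measurable_fun cp.
have mPw : measurable_fun Omega (Phi \o w) by exact: (measurableT_comp mPhi).
have mpw : measurable_fun Omega (p \o w) by exact: (measurableT_comp mp).
pose Fw i x := kappa (w x) * Defs.coord Gw i x.
have L1Fw i : L1 Omega (fun x => Fw i x ^+ 2).
  have [_] := L2Fw i; rewrite /L1; congr (integrable _ _ _).
  by apply/funext => x; rewrite /= /Defs.coord mxE.
have kw0 x : Omega x -> 0 <= kappa (w x) by move=> Ox; rewrite coefficient_ge0// w0.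
have pw0 x : Omega x -> 0 <= p (w x) <= kappa (w x) by move=> Ox; apply: p_kappa; exact: w0.
have mG i : measurable_fun Omega (Defs.coord Gw i) by have [] := GwL i.
have mk := measurable_coefficient hkappa mw w0.
have H1 : H1_grad Omega (Phi \o w) (fun x => p (w x) *: Gw x).
  split => //; first exact: (L2_bounded oO bO mPw (fun x _ => PhiB (w x))).
  move=> i; have mpG : measurable_fun Omega
      (Defs.coord (fun x => p (w x) *: Gw x) i).
    rewrite (_ : Defs.coord _ i = (fun x => p (w x) * Defs.coord Gw i x)).
      exact: measurable_funM.
    by apply/funext => x; rewrite /Defs.coord mxE.
  split => //; apply: le_integrable (L1Fw i) => //.
    by apply/measurable_EFinP; exact: measurable_funX.
  move=> x Ox; rewrite /= lee_fin !ger0_norm ?sqr_ge0// /Fw /Defs.coord mxE.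
  have /andP[p0 pk] := pw0 x Ox.
  by rewrite !exprMn ler_wpM2r ?sqr_ge0// lerXn2r// nnegrE// kw0.
have LPhi : Linfty Omega (Phi \o w).
  by split => //; exists 1; apply: aeW => x _; exact: PhiB.
(* the source term has dropped out, as the dissipation is 0 almost everywhere *)
have flux : \int[mu]_(x in Omega) (kappa (w x) * p (w x) * dotv (Gw x) (Gw x)) = 0.
  have := noflux _ _ H1 LPhi; rewrite /normal_trace.
  rewrite [X in _ + X]Rintegral_ae0//; last 2 first.
  - by apply: measurable_funM => //; exact: measurable_funN.
  - by apply: filterS diss0 => x h /h /= ->; rewrite oppr0 mul0r.
  rewrite addr0 => h; rewrite -[RHS]h; apply: eq_Rintegral => x _.
  rewrite /dotv mulr_sumr; apply: eq_bigr => i _; rewrite !mxE; ring.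
have iflux : mu.-integrable Omega
    (EFin \o (fun x => kappa (w x) * p (w x) * dotv (Gw x) (Gw x))).
  have iS : mu.-integrable Omega (EFin \o (fun x => \sum_i Fw i x ^+ 2)).
    have := integrable_sum mO (index_enum 'I_n) (P := xpredT) (fun i _ => L1Fw i).
    by congr (integrable _ _ _); apply/funext => x /=; rewrite sumEFin.
  apply: le_integrable iS => //.
    apply/measurable_EFinP; apply: measurable_funM; first exact: measurable_funM.
    exact: measurable_dotv.
  move=> x Ox; have /andP[p0 pk] := pw0 x Ox; have k0 := kw0 x Ox.
  rewrite /= lee_fin !ger0_norm; last 2 first.
  - by apply: sumr_ge0 => i _; exact: sqr_ge0.
  - by rewrite mulr_ge0 ?dotv_ge0// mulr_ge0.
  rewrite /dotv mulr_sumr; apply: ler_sum => i _.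
  rewrite /Fw /Defs.coord exprMn -expr2 ler_wpM2r ?sqr_ge0//.
  by rewrite expr2 ler_wpM2l.
have flux0 := Rintegral_eq0_ae mO iflux _ flux.
have pG0 : {ae mu, forall x, Omega x -> p (w x) *: Gw x = 0}.
  have ge0 x : Omega x -> 0 <= kappa (w x) * p (w x) * dotv (Gw x) (Gw x).
    move=> Ox; have /andP[p0 _] := pw0 x Ox.
    by rewrite mulr_ge0 ?dotv_ge0// mulr_ge0// kw0.
  apply: filterS (flux0 ge0) => x h Ox; move/eqP: (h Ox).
  have := w0 _ Ox; rewrite le_eqVlt => /predU1P[w_eq0|wpos].
    have /andP[p00 p0k] := p_kappa 0 (lexx 0).
    (* [grad w] is not controlled where [w = 0], but [Phi'(0) = 0], as [Phi' <= kappa] *)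
    have p0 : p 0 = 0.
      apply/eqP; rewrite eq_le p00 andbT; apply: le_trans p0k _.
      by have [_ -> _] := hkappa.
    by rewrite -w_eq0 p0 scale0r.
  have kpos : 0 < kappa (w x) by case: hkappa => _ _; exact.
  rewrite !mulf_eq0 (gt_eqF kpos) (gt_eqF (p_gt0 _ wpos)) /= => /eqP /dotv_eq0 ->.
  by rewrite scaler0.
have [c0 Phic] := weak_grad0_const oO cO nO wGPhi pG0.
have [x1 Ox1 Phix1] : exists2 x, Omega x & Phi (w x) = c0.
  apply: (ae_witness mO) Phic; case: nO => y Oy.
  by apply: (lebesgue_nbhs_gt0 mO (x := y)); exact: open_nbhs_nbhs.
exists (w x1); split; first exact: w0.
  apply: filterS Phic => x h Ox; apply: Phi_inj; [exact: w0|exact: w0|].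
  by rewrite Phix1 -(h Ox).
by exists Gv.
Qed.

End constancy.

(** * The classification of steady states *)

Theorem proposition3p1 (R : realType) (d : nat) (Omega : set 'rV[R]_d.+1)
    (eta kappa : R -> R)
    (hOmega : bounded_lipschitz_domain Omega)
    (heta : degenerate_coefficient eta)
    (hkappa : degenerate_coefficient kappa)
    (v w : 'rV[R]_d.+1 -> R)
    (hv : W11loc Omega v) (hw : W11loc Omega w)
    (hw0 : forall x, Omega x -> 0 <= w x) :
  steady_state eta kappa Omega v w <->
    {ae lebesgue_rV R d.+1, forall x, Omega x -> w x = 0} \/
    exists V0 W0 : R,
      [/\ unique (conserved Omega v w) (V0, W0),
          {ae lebesgue_rV R d.+1, forall x, Omega x ->
             v x = (volume Omega)^-1 * V0} &
          {ae lebesgue_rV R d.+1, forall x, Omega x ->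
             w x = (volume Omega)^-1 * W0}].
Proof.
have [oO cO nO bO _] := hOmega.
have vol0 := volume_gt0 oO bO nO.
have [[Gv wGv] [Gw wGw]] := (hv, hw).
have [[mv _] _ _] := wGv; have [[mw _] _ _] := wGw.
split.
  move=> /(steady_state_w_const oO cO nO bO heta hkappa).
  move=> [c [c_ge0 wc [G wG diss0]]].
  move: c_ge0; rewrite le_eqVlt => /predU1P[c0|cpos].
    by left; rewrite c0.
  right; have eta_pos : 0 < eta c by case: heta => _ _; exact.
  have [b vb] : exists b, {ae lebesgue_rV R d.+1, forall x, Omega x -> v x = b}.
    apply: weak_grad0_const wG _ => //.
    apply: filterS2 wc diss0 => x h1 h2 Ox; apply: dotv_eq0.
    by move: (h2 Ox) => /eqP; rewrite (h1 Ox) mulf_eq0 (gt_eqF eta_pos) => /eqP.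
  have cP := conserved_const oO bO nO _ mv mw vb wc.
  exists (volume Omega * b), (volume Omega * c); split.
  - by split=> [|p /cP ->//]; apply/cP.
  - by apply: filterS vb => x h /h ->; rewrite mulKf// gt_eqF.
  - by apply: filterS wc => x h /h ->; rewrite mulKf// gt_eqF.
move=> [wz|[V0 [W0 [_ vc wc]]]].
  apply: (steady_state_flux0 heta hkappa oO hw0 wGv wGw).
    by apply: filterS wz => x h /h ->; case: heta => _ -> _; rewrite scale0r.
  by apply: filterS wz => x h /h ->; case: hkappa => _ -> _; rewrite scale0r.
have [vL _ _] := wGv; have [wL _ _] := wGw.
apply: (steady_state_flux0 heta hkappa oO hw0
  (weak_grad_const oO vL vc) (weak_grad_const oO wL wc)).
  by apply: aeW => x _; rewrite scaler0.
by apply: aeW => x _; rewrite scaler0.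
Qed.
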